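(* Let $G$ be a countably infinite discrete amenable group and let $G\curvearrowright X$ be a free action by homeomorphisms on a compact metrizable space. If the action has property FCSB in measure, then it has the Uniform Rokhlin Property (URP).
   Context: A set $U\subset X$ is $F$-free (for finite $F\subset G$) if the translates $gU$, $g\in F$, are pairwise disjoint. $M_G(X)$ is the set of $G$-invariant Borel probability measures on $X$. Property FCSB in measure: for every finite $F\subset G$ and every $\varepsilon>0$ there is a finite collection $\{U_i\}_{i=1}^n$ of $F$-free open subsets of $X$ such that $\sum_{i=1}^n\mu(\partial U_i)+\mu\left(X\setminus\bigcup_{i=1}^nU_i\right)<\varepsilon$ for every $\mu\in M_G(X)$. A finite set $S\subset G$ is $(K,\varepsilon)$-invariant if $\left|\bigcap_{g\in K}gS\right|>(1-\varepsilon)|S|$. For $A\subset X$ the upper Banach density is $\overline{D}(A)=\inf_F\sup_{x\in X}\frac{|A\cap Fx|}{|F|}$, the infimum being over nonempty finite $F\subset G$. A tower is a pair $(S,V)$ with $S\subset G$ finite (the shape) and $V\subset X$ open such that the sets $gV$, $g\in S$, are pairwise disjoint; $SV=\bigcup_{g\in S}gV$. A castle is a finite collection of towers $\{(S_i,V_i)\}_{i=1}^n$ with the sets $S_iV_i$ pairwise disjoint. URP: for every finite $K\subset G$ and every $\varepsilon>0$ there is a castle $\{(S_i,V_i)\}_{i=1}^n$ whose shapes are $(K,\varepsilon)$-invariant and such that $\overline{D}\left(X\setminus\bigsqcup_{i=1}^nS_iV_i\right)<\varepsilon$. *)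

(* Defs.v *)
From HB Require Import structures.
From mathcomp Require Import all_boot all_order all_algebra finmap.
From mathcomp Require Import all_classical all_reals all_analysis.

Set Implicit Arguments.
Unset Strict Implicit.
Unset Printing Implicit Defensive.

Import Order.TTheory GRing.Theory Num.Theory.

Local Open Scope classical_set_scope.
Local Open Scope ring_scope.

Definition metrizable (R : realType) (X : topologicalType) : Prop :=
  exists d : X -> X -> R,
    [/\ forall x y, d x y = 0 <-> x = y,
        forall x y, d x y = d y x,
        forall x y z, d x z <= d x y + d y z
      & forall x (A : set X), nbhs x A <->
          exists2 e : R, 0 < e & [set y | d x y < e] `<=` A].

Definition boundary (X : topologicalType) (A : set X) : set X :=
  closure A `\` interior A.

(* The library's measurable spaces are pointed. To cover a possibly empty X,
   the base point is an explicit parameter; it affects neither the underlying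
   type X nor its Borel sets. *)
Definition pointed_at (X : topologicalType) (x0 : X) : Type := X.
HB.instance Definition _ (X : topologicalType) (x0 : X) :=
  Choice.on (pointed_at x0).
HB.instance Definition _ (X : topologicalType) (x0 : X) :=
  isPointed.Build (pointed_at x0) x0.

Definition borel_space (X : topologicalType) (x0 : X) :=
  g_sigma_algebraType (T := pointed_at x0) (@open X).

Definition is_action (G : groupType) (X : Type) (act : G -> X -> X) : Prop :=
  (forall x, act 1%g x = x) /\
  (forall g h x, act (g * h)%g x = act g (act h x)).

(* Continuity of every act g suffices: act g^-1 is the inverse of act g. *)
Definition action_by_homeo (G : groupType) (X : topologicalType)
    (act : G -> X -> X) : Prop :=
  is_action act /\ forall g, continuous (act g).

Definition free_action (G : groupType) (X : Type) (act : G -> X -> X) : Prop :=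
  forall g x, act g x = x -> g = 1%g.

(* The intersection is taken in G, so for K = fset0 it is the whole group; the
   counting measure takes the value +oo on infinite sets. *)
Definition KE_invariant (R : realType) (G : groupType) (K : {fset G})
    (eps : R) (S : {fset G}) : Prop :=
  (((1 - eps) * #|` S|%:R)%:E <
    counting (\bigcap_(g in [set` K]) [set (g * s)%g | s in [set` S]]))%E.

(* Amenability of a discrete group, via the Foelner condition. *)
Definition amenable (R : realType) (G : groupType) : Prop :=
  forall (K : {fset G}) (eps : R), 0 < eps ->
    exists2 S : {fset G}, S != fset0 & KE_invariant K eps S.

Section Dynamics.
Context (R : realType) (G : groupType) (X : topologicalType).
Variable act : G -> X -> X.

Definition disjoint_translates (F : {fset G}) (U : set X) : Prop :=
  trivIset [set` F] (fun g => act g @` U).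

Definition invariant_measure (x0 : X) (mu : probability (borel_space x0) R) :
    Prop :=
  forall (g : G) (A : set (borel_space x0)), measurable A ->
    mu (act g @` A) = mu A.

Definition FCSB_in_measure : Prop :=
  forall (F : {fset G}) (eps : R), 0 < eps ->
    exists (n : nat) (U : 'I_n -> set X),
      (forall i, open (U i) /\ disjoint_translates F (U i)) /\
      forall (x0 : X) (mu : probability (borel_space x0) R),
        invariant_measure mu ->
        (\sum_(i < n) mu (boundary (U i)) +
          mu (~` \bigcup_(i in [set: 'I_n]) U i) < eps%:E)%E.

(* The real sup of the empty set is 0, hence so is the density when X is
   empty. *)
Definition upper_banach_density (A : set X) : R :=
  inf [set sup [set #|` fset_set (A `&` [set act g x | g in [set` F]])|%:R
                     / #|` F|%:R | x in [set: X]]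
      | F in [set F : {fset G} | F != fset0]].

Definition tower (S : {fset G}) (V : set X) : Prop :=
  open V /\ disjoint_translates S V.

Definition tower_support (S : {fset G}) (V : set X) : set X :=
  \bigcup_(g in [set` S]) act g @` V.

Definition castle (n : nat) (S : 'I_n -> {fset G}) (V : 'I_n -> set X) : Prop :=
  (forall i, tower (S i) (V i)) /\
  trivIset [set: 'I_n] (fun i => tower_support (S i) (V i)).

Definition URP : Prop :=
  forall (K : {fset G}) (eps : R), 0 < eps ->
    exists (n : nat) (S : 'I_n -> {fset G}) (V : 'I_n -> set X),
      [/\ castle S V, forall i, KE_invariant K eps (S i)
        & upper_banach_density
            (~` \bigcup_(i in [set: 'I_n]) tower_support (S i) (V i)) < eps].

End Dynamics.

(* Main.v *)
(* Write "mean" for a finitely additive invariant probability on all subsets of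
   X. Ultralimits of means give compactness, a closed set is bounded uniformly
   over means as soon as it is over invariant measures (Caratheodory's
   construction turns a mean into a measure that does not decrease closed sets),
   and a set that is small for every mean has small upper Banach density
   (ultralimits along Foelner sets).

   FCSB gives, for E finite, a colouring of X with finitely many open E-free
   colours off a closed set that is small for every mean. An Ornstein-Weiss
   quasitiling that goes through the colours one after the other multiplies the
   size of the uncoloured set by a constant depending on the number of colours,
   whereas FCSB gives no bound on that number in terms of E alone. So the number
   of colours is first reduced to a bound depending only on E, at the cost of a
   factor 2 in the size of the uncoloured set.

   The reduction iterates a Cole-Vishkin step: the new colour of x lists, for
   every g in E, a bit where the colours of x and g x differ. A point that is
   only partly coloured (0 < u < 1 below) may count as coloured for one neighbour
   and not for another. Letting the |E| neighbours start to take it into account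
   at distinct values of u, one after the other, at most one of them has an
   ambiguous new colour at any moment, so ambiguity moves but hardly
   multiplies. *)

Require Import Defs.
From HB Require Import structures.
From mathcomp Require Import all_boot all_order all_algebra finmap.
From mathcomp Require Import all_classical all_reals all_analysis.
From mathcomp Require Import ring lra zify.

Set Implicit Arguments.
Unset Strict Implicit.
Unset Printing Implicit Defensive.

Import Order.TTheory GRing.Theory Num.Theory.
Import numFieldNormedType.Exports.

Local Open Scope fset_scope.
Local Open Scope classical_set_scope.
Local Open Scope ring_scope.

(** * Invariant means *)

Section InvariantMeans.
Context (R : realType) (G : groupType) (X : Type) (act : G -> X -> X).

Record invariant_mean (m : set X -> R) : Prop := InvariantMean {
  mean_setT : m setT = 1;
  mean_ge0 : forall A, 0 <= m A;
  meanU : forall A B, A `&` B = set0 -> m (A `|` B) = m A + m B;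
  mean_translate : forall g A, m (act g @^-1` A) = m A }.

Variable m : set X -> R.
Hypothesis hm : invariant_mean m.

Lemma mean_set0 : m set0 = 0.
Proof.
have := meanU hm (setI0 set0); rewrite setU0 => h.
by apply: (addrI (m set0)); rewrite addr0 -h.
Qed.

Lemma le_mean A B : A `<=` B -> m A <= m B.
Proof.
move=> AB; have -> : B = A `|` (B `\` A) by rewrite setDUK.
by rewrite (meanU hm) ?setDIK// lerDl (mean_ge0 hm).
Qed.

Lemma mean_le1 A : m A <= 1.
Proof. by rewrite -(mean_setT hm); exact: le_mean. Qed.

Lemma mean_setC A : m (~` A) = 1 - m A.
Proof. by rewrite -(mean_setT hm) -(setUv A) (meanU hm) ?setICr// addrC addKr. Qed.

Lemma meanD A B : m (A `\` B) = m A - m (A `&` B).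
Proof.
have -> : m A = m (A `&` B) + m (A `\` B).
  rewrite -(meanU hm); last by rewrite setDE setIACA setICr setI0.
  by rewrite setUC -setDDr setDv setD0.
by rewrite addrC addKr.
Qed.

Lemma le_meanU A B : m (A `|` B) <= m A + m B.
Proof.
have -> : A `|` B = A `|` (B `\` A).
  by rewrite setDE setUIr setUv setIT.
by rewrite (meanU hm) ?setDIK// lerD2l le_mean.
Qed.

Lemma mean_partition (T : finType) (f : X -> T) A :
  m A = \sum_t m (A `&` f @^-1` [set t]).
Proof.
suff H (s : seq T) : uniq s ->
    m (A `&` [set x | f x \in s]) = \sum_(t <- s) m (A `&` f @^-1` [set t]).
  rewrite -(H (index_enum T)) ?index_enum_uniq//; congr m.
  by apply/seteqP; split=> [x Ax|x []//]; split=> //=; rewrite mem_index_enum.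
elim: s => [_|t s IH /= /andP[ts us]].
  by rewrite big_nil (_ : _ `&` _ = set0) ?mean_set0//; apply/seteqP; split=> x // [].
rewrite big_cons -IH// -(meanU hm).
  congr m; apply/seteqP; split=> x /=.
    by case=> Ax; rewrite inE => /orP[/eqP ?|?]; [left|right].
  by case=> -[Ax]; [move=> ->; rewrite inE eqxx|rewrite inE => ->; rewrite orbT].
apply/seteqP; split=> x //= [[_ ft] [_ fs]].
by move: ts; rewrite -ft fs.
Qed.

(** Double counting: on the cell of points with a given membership pattern [T], the right side
    counts the cell [#|T| >= k] times. *)
Lemma mean_count (J : finType) (B : J -> set X) W k :
  (forall x, W x -> (k <= #|[set j | `[< B j x >]]%SET|)%N) ->
  k%:R * m W <= \sum_j m (B j).
Proof.
move=> hk; pose pat x := [set j | `[< B j x >]]%SET.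
rewrite (mean_partition pat W) mulr_sumr.
apply: (@le_trans _ _ (\sum_j \sum_(T : {set J}) m ((W `&` B j) `&` pat @^-1` [set T]))).
  rewrite exchange_big /=; apply: ler_sum => T _.
  rewrite (bigID (mem T)) /= -[leLHS]addr0 lerD//; last first.
    by apply: sumr_ge0 => j _; apply: mean_ge0.
  rewrite (eq_bigr (fun=> m (W `&` pat @^-1` [set T]))); last first.
    move=> j jT; congr m; apply/seteqP; split=> x [].
      by move=> [? ?] ?.
    by move=> Wx xT; split=> //; split=> //; move: jT; rewrite -xT inE => /asboolP.
  rewrite sumr_const -[leRHS]mulr_natl.
  have [->|/set0P[x [Wx xT]]] := eqVneq (W `&` pat @^-1` [set T]) set0.
    by rewrite mean_set0 !mulr0.
  by rewrite ler_wpM2r ?(mean_ge0 hm)// ler_nat -xT; apply: hk.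
apply: ler_sum => j _; rewrite -(mean_partition pat); apply: le_mean.
exact: subIsetr.
Qed.

Lemma le_mean_bigcup (J : finType) (B : J -> set X) A :
  A `<=` \bigcup_j B j -> m A <= \sum_j m (B j).
Proof.
move=> AB; rewrite -[m A]mul1r -[1]/(1%:R); apply: mean_count => x /AB[j _ Bj].
by apply/card_gt0P; exists j; rewrite inE; apply/asboolP.
Qed.

Lemma sum_mean_le (J : finType) (B : J -> set X) A :
  (forall j, B j `<=` A) -> (forall i j x, B i x -> B j x -> i = j) ->
  \sum_j m (B j) <= m A.
Proof.
move=> BA Bdisj; pose f x := [pick j | `[< B j x >]].
rewrite (mean_partition f A) (bigD1 None)//= -[leLHS]add0r lerD ?(mean_ge0 hm)//.
rewrite [leRHS](reindex_omap Some id)/=; last by case.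
rewrite le_eqVlt; apply/orP; left; apply/eqP.
apply: eq_big => [j|j _]; first by rewrite eqxx.
congr m; apply/seteqP; split=> x /=.
  move=> Bj; split; first exact: BA Bj.
  rewrite /f; case: pickP => [i /asboolP Bi|/(_ j)/asboolP//].
  by rewrite (Bdisj _ _ _ Bi Bj).
by case=> _; rewrite /f; case: pickP => // i /asboolP Bi [<-].
Qed.

End InvariantMeans.

(** All values lie in [[0, 1]], so by compactness they converge along an ultrafilter refining [F].
    Invariance that holds asymptotically along [F] becomes exact in the limit. *)
Lemma mean_ultralimit (R : realType) (G : groupType) (X : Type)
    (act : G -> X -> X) (I : Type) (F : set_system I) (FF : ProperFilter F)
    (p : I -> set X -> R) :
  (forall i, p i setT = 1) -> (forall i A, 0 <= p i A) ->
  (forall i A B, A `&` B = set0 -> p i (A `|` B) = p i A + p i B) ->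
  (forall g A (e : R), 0 < e -> F [set i | `|p i (act g @^-1` A) - p i A| <= e]) ->
  exists m, invariant_mean act m /\
    forall A r, F [set i | r <= p i A] -> r <= m A.
Proof.
move=> p1 p0 pU pinv.
have ple1 i A : p i A <= 1.
  by rewrite -(p1 i) -(setUv A) pU ?setICr// lerDl.
have [U [UU FU]] := ultraFilterLemma FF.
have UF : ProperFilter U := ultra_proper.
have lim_ex A : exists l : R, p^~ A @ U --> l.
  have [|l [_ cl]] := @segment_compact R 0 1 (p^~ A @ U) _.
    apply: (@filterS _ U _ setT) => [i _|]; last exact: filterT.
    by rewrite /= in_itv/= p0 ple1.
  exists l => N Nl; have [//|UN] := in_ultra_setVsetC (p^~ A @^-1` N) UU.
  by have [x [Nx NNx]] := cl (~` N) N UN Nl; case: (Nx NNx).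
have [m hm] := choice lim_ex.
have m_uniq A (l : R) : p^~ A @ U --> l -> m A = l.
  by move=> h; exact: (@norm_cvg_unique _ R _ _ _ _ (hm A) h).
exists m; split; last first.
  by move=> A r /FU h; apply: (cvgr_to_ge (hm A)).
split=> [|A|A B AB|g A].
- apply: m_uniq; rewrite (_ : p^~ setT = cst 1); first exact: cvg_cst.
  by apply/funext => i; rewrite p1.
- by apply: (cvgr_to_ge (hm A)); apply: nearW => i; apply: p0.
- apply: m_uniq; rewrite (_ : p^~ (A `|` B) = p^~ A \+ p^~ B).
    exact: cvgD (hm A) (hm B).
  by apply/funext => i /=; rewrite pU.
- apply/eqP; rewrite -subr_eq0 -normr_le0; apply/ler_addgt0Pr => e e0.
  rewrite add0r; apply: (cvgr_to_le (cvg_norm (cvgB (hm _) (hm _)))).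
  exact/FU/pinv.
Qed.

(** * Foelner sets and upper Banach density *)

Lemma counting_le (R : realType) (T : choiceType) (A : set T) (S : {fset T}) :
  A `<=` [set` S] -> (counting A <= (#|` S|%:R : R)%:E)%E.
Proof.
move=> AS; have fA : finite_set A by apply: sub_finite_set AS _.
rewrite /counting asboolT// lee_fin ler_nat fsubset_leq_card//.
by apply/fsubsetP => x; rewrite in_fset_set// inE => /AS.
Qed.

Lemma counting_ge (R : realType) (T : choiceType) (A : set T) (S : {fset T}) :
  [set` S] `<=` A -> ((#|` S|%:R : R)%:E <= counting A)%E.
Proof.
move=> SA; rewrite /counting; case: ifPn => [/asboolP fA|_]; last exact: leey.
rewrite lee_fin ler_nat fsubset_leq_card//.
by apply/fsubsetP => x xS; rewrite in_fset_set// inE; apply: SA.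
Qed.

Lemma amenable_Folner (R : realType) (G : groupType) :
  amenable R G -> forall (K : {fset G}) (d : R), 0 < d ->
  exists2 S : {fset G}, S != fset0 & forall g, g \in K ->
    #|` [fset s in S | (g * s)%g \notin S]|%:R <= d * #|` S|%:R.
Proof.
move=> am K d d0.
(* The element [1] keeps the intersection inside [S], and [g^-1] makes its points [s] satisfy
   [g * s \in S]. *)
have [S S0 hS] := am (1%g |` [fset g^-1%g | g in K])%fset d d0.
exists S => // g gK; move: hS; rewrite /KE_invariant => /lt_le_trans.
move=> /(_ (#|` [fset s in S | (g * s)%g \in S]|%:R)%:E).
have -> : [fset s in S | (g * s)%g \notin S]%fset =
    (S `\` [fset s in S | (g * s)%g \in S])%fset.
  by apply/fsetP => x; rewrite !inE /= andbC; case: (x \in S); rewrite ?andbF ?andbT//= ?andbT.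
rewrite cardfsD (fsetIidPr _); last by apply/fsubsetP => x; rewrite !inE => /andP[].
set a := #|` _|; set b := #|` S|.
have ab : (a <= b)%N.
  by apply: fsubset_leq_card; apply/fsubsetP => x; rewrite !inE => /andP[].
rewrite natrB// lte_fin => h.
suff : (1 - d) * b%:R < a%:R by lra.
apply: h; apply: counting_le => z hz /=.
have : z \in S.
  have /(_ 1%g)[|s sS <-] := hz; last by rewrite mul1g.
  by rewrite /= !inE eqxx.
rewrite !inE /= => -> /=.
have /(_ g^-1%g)[|s sS <-] := hz; last by rewrite mulVKg.
by rewrite /= !inE in_imfset ?orbT.
Qed.

Section DensityOfMeans.
Context (R : realType) (G : groupType) (X : topologicalType).
Variable act : G -> X -> X.
Hypothesis actP : is_action act.
Hypothesis G_amenable : amenable R G.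

Let freq (S : {fset G}) (x : X) (B : set X) : R :=
  #|` [fset s in S | `[< B (act s x) >]]|%:R / #|` S|%:R.

Let freq_translate (S : {fset G}) x g B (d : R) : S != fset0 ->
  #|` [fset s in S | (g * s)%g \notin S]|%:R <= d * #|` S|%:R ->
  freq S x (act g @^-1` B) <= freq S x B + d.
Proof.
move=> S0 hS; have cS : (0 : R) < #|` S|%:R by rewrite ltr0n cardfs_gt0.
rewrite /freq ler_pdivrMr// mulrDl divfK ?gt_eqF//.
apply: le_trans (lerD (lexx _) hS); rewrite -natrD ler_nat.
set A := [fset s in S | (g * s)%g \notin S]%fset.
set B1 := [fset s in S | `[< (act g @^-1` B) (act s x) >]]%fset.
set B2 := [fset s in S | `[< B (act s x) >]]%fset.
have /fsubset_leq_card : (B1 `<=` [fset (g^-1 * s)%g | s in B2] `|` A)%fset.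
  apply/fsubsetP => s; rewrite !inE /= => /andP[sS /asboolP Bs].
  have [gs|/= gs] := boolP ((g * s)%g \in S); last by rewrite sS orbT.
  apply/orP; left; apply/imfsetP; exists (g * s)%g; last by rewrite mulKg.
  by rewrite !inE /= gs; apply/asboolP; rewrite actP.2.
move=> /leq_trans; apply; rewrite cardfsU (leq_trans (leq_subr _ _))// leq_add2r.
exact: leq_imfset_card.
Qed.

(** If the density were at least [e], every Foelner set would have a point whose orbit along it
    visits [C] with frequency almost [e]. An ultralimit of these orbit frequencies is an invariant
    mean giving [C] at least [e]. *)
Lemma upper_banach_density_lt (C : set X) (e : R) : 0 < e ->
  (forall m : set X -> R, invariant_mean act m -> m C < e) ->
  upper_banach_density R act C < e.
Proof.
move=> e0 hC; rewrite ltNge; apply/negP => he.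
pose I := ({fset G} * nat)%type.
have freq0 S x B : 0 <= freq S x B by rewrite divr_ge0.
have hex (i : I) : exists Sx : {fset G} * X,
    [/\ Sx.1 != fset0, forall g, g \in i.1 ->
      #|` [fset s in Sx.1 | (g * s)%g \notin Sx.1]|%:R
        <= i.2.+1%:R^-1 * #|` Sx.1|%:R :> R &
      e - i.2.+1%:R^-1 <= freq Sx.1 Sx.2 C].
  case: i => K n /=.
  have d0 : 0 < n.+1%:R^-1 :> R by [].
  have [S S0 hS] := amenable_Folner G_amenable K d0.
  pose Q := [set #|` fset_set (C `&` [set act g x | g in [set` S]])|%:R
                     / #|` S|%:R | x in [set: X]] : set R.
  have eQ : e <= sup Q.
    apply: (le_trans he); apply: ge_inf; last by exists S.
    exists 0 => _ [F _ <-]; set Q' := (X in sup X).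
    have [[[y Q'y] ubQ]|/sup_out-> //] := pselect (has_sup Q').
    apply: (@le_trans _ _ y); last exact: ub_le_sup.
    by case: Q'y => x _ <-; rewrite divr_ge0.
  (* This is the case of an empty [X], where the default value [0] of [sup] contradicts [0 < e]. *)
  have [Q0|Q0] := pselect (Q = set0).
    by move: eQ; rewrite Q0 sup0 leNgt e0.
  have ltQ : e - n.+1%:R^-1 < sup Q by rewrite ltrBlDr; apply: le_lt_trans eQ _; rewrite ltrDl.
  have [|_ [x _ <-] hx] := sup_gt _ ltQ; first exact/set0P/eqP.
  exists (S, x); split=> //=; apply: le_trans (ltW hx) _.
  (* Passing from points of the orbit to times [s] can only increase the count. *)
  rewrite ler_wpM2r// ler_nat.
  apply: (@leq_trans #|` [fset act s x | s in [fset s in S | `[< C (act s x) >]]]%fset|).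
    apply: fsubset_leq_card; apply/fsubsetP => y.
    rewrite in_fset_set; last first.
      by apply: sub_finite_set (@subIsetr _ _ _) _; apply: finite_image.
    rewrite inE => -[Cy [s /= sS sy]]; apply/imfsetP; exists s => //.
    by rewrite /= !inE /= sS; apply/asboolP; rewrite sy.
  exact: leq_imfset_card.
have [Sx hSx] := choice hex.
pose F : set_system I := fun P =>
  exists i0 : I, forall i : I, (i0.1 `<=` i.1)%fset -> (i0.2 <= i.2)%N -> P i.
have FF : ProperFilter F.
  split=> [[i0 /(_ i0)]|]; first by apply=> //; apply: fsubset_refl.
  split=> [|P Q [i hi] [j hj]|P Q PQ [i hi]].
  - by exists (fset0, 0%N).
  - exists ((i.1 `|` j.1)%fset, maxn i.2 j.2) => k /=.
    rewrite fsubUset geq_max => /andP[? ?] /andP[? ?].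
    by split; [apply: hi|apply: hj].
  - by exists i => k ? ?; apply: PQ; apply: hi.
have inv_small (d : R) : 0 < d -> exists n, forall k, (n <= k)%N -> k.+1%:R^-1 <= d.
  move=> d0; exists (Num.truncn d^-1) => k nk.
  rewrite -[leRHS]invrK lef_pV2 ?posrE ?invr_gt0//.
  apply: le_trans (ltW (truncnS_gt _)) _; rewrite ler_nat ltnS//.
have [||||m [hm mC]] := @mean_ultralimit R G X act I F FF
    (fun i => freq (Sx i).1 (Sx i).2).
- move=> i; have [S0 _ _] := hSx i; rewrite /freq.
  rewrite (_ : [fset _ in _ | _]%fset = (Sx i).1) ?divff ?pnatr_eq0 ?cardfs_eq0//.
  by apply/fsetP => s; rewrite !inE /= asboolT// andbT.
- by move=> i A; apply: freq0.
- move=> i A B AB; rewrite /freq -mulrDl -natrD; congr (_%:R / _).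
  rewrite -[RHS]cardfsUI (_ : (_ `&` _)%fset = fset0) ?cardfs0 ?addn0; last first.
    apply/fsetP => s; rewrite !inE /=; apply/negbTE/negP.
    move=> /andP[/andP[_ /asboolP As] /andP[_ /asboolP Bs]].
    by have : (A `&` B) (act s (Sx i).2) by []; rewrite AB.
  congr #|` _|; apply/fsetP => s; rewrite !inE /= -andb_orr; congr (_ && _).
  by apply/asboolP/orP => -[] h; [left|right|left|right]; apply/asboolP.
- move=> g A d d0; have [n hn] := inv_small d d0.
  exists ([fset g; g^-1%g]%fset, n) => -[K k] /= /fsubsetP gK nk.
  have [S0 hS _] := hSx (K, k); move: hS S0 => /=.
  case: (Sx _) => S x /= hS S0.
  have gK1 : g \in K by apply: gK; rewrite !inE eqxx.
  have gK2 : (g^-1)%g \in K by apply: gK; rewrite !inE eqxx orbT.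
  rewrite ler_norml; apply/andP; split.
    have := freq_translate x (act g @^-1` A) S0 (hS _ gK2).
    rewrite (_ : act (g^-1)%g @^-1` _ = A); last first.
      by apply/funext => z; rewrite /preimage /= -actP.2 mulgV actP.1.
    by rewrite lerNl opprB lerBlDl => /le_trans; apply; rewrite lerD2l hn.
  rewrite lerBlDl; apply: le_trans (freq_translate x A S0 (hS _ gK1)) _.
  by rewrite lerD2l hn.
suff : e <= m C by rewrite leNgt hC.
apply/ler_addgt0Pr => d d0; rewrite -lerBlDr; apply: mC.
have [n hn] := inv_small d d0; exists (fset0, n) => -[K k] /= _ nk.
have [_ _] := hSx (K, k); apply: le_trans.
by rewrite lerD2l lerN2 hn.
Qed.

End DensityOfMeans.

(** * From means to measures *)

Lemma metrizable_hausdorff (R : realType) (X : topologicalType) :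
  metrizable R X -> hausdorff_space X.
Proof.
move=> [d [d0 dC dD dN]]; rewrite open_hausdorff => x y xy.
have dxx z : d z z = 0 by apply/d0.
have dge0 z w : 0 <= d z w.
  by have := dD z w z; rewrite dxx (dC w z); lra.
have dxy : 0 < d x y.
  rewrite lt_neqAle dge0 andbT eq_sym; apply/eqP => /d0 xy0.
  by rewrite xy0 eqxx in xy.
pose B z := [set w | d z w < d x y / 2].
have BN z : nbhs z (B z) by apply/dN; exists (d x y / 2); rewrite ?divr_gt0.
exists (interior (B x), interior (B y)) => /=.
  by split; rewrite inE /interior.
split; [exact: open_interior|exact: open_interior|].
apply/eqP/seteqP; split=> z // -[/interior_subset zx /interior_subset zy].
by have := dD x z y; rewrite (dC z y); move: zx zy; rewrite /B /=; lra.
Qed.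

Lemma outer_measure_bigcup_finType (R : realType) (T : Type)
    (mu : {outer_measure set T -> \bar R}) (J : finType) (B : J -> set T) :
  (mu (\bigcup_j B j) <= \sum_j mu (B j))%E.
Proof.
have -> : \bigcup_j B j = \big[setU/set0]_(j <- index_enum J) B j.
  rewrite -bigcup_seq; congr bigcup; apply/seteqP; split=> j //= _.
  exact: mem_index_enum.
elim: (index_enum J) => [|j s IH]; first by rewrite !big_nil outer_measure0.
rewrite !big_cons; apply: le_trans (outer_measureU2 _ _ _) _.
exact: leeD2l.
Qed.

Section MeasureOfMean.
Context (R : realType) (G : groupType) (X : topologicalType).
Variable act : G -> X -> X.
Hypothesis X_compact : compact [set: X].
Hypothesis X_hausdorff : hausdorff_space X.
Hypothesis act_homeo : action_by_homeo act.
Variable m : set X -> R.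
Hypothesis hm : invariant_mean act m.

Local Open Scope ereal_scope.

Let normalX := (@normal_openP R X).1 (compact_normal X_hausdorff X_compact).

(* The outer measure of A is the infimum over open U containing A of the
   supremum of m over closed subsets of U, as for Haar measure or the Riesz
   theorem; m itself is not countably additive. *)
Definition inner_content (U : set X) : \bar R :=
  ereal_sup [set (m C)%:E | C in [set C | closed C /\ C `<=` U]].

Definition outer_content (A : set X) : \bar R :=
  ereal_inf [set inner_content U | U in [set U | open U /\ A `<=` U]].

Lemma inner_content_ge U C : closed C -> C `<=` U -> (m C)%:E <= inner_content U.
Proof. by move=> cC CU; apply: ereal_sup_ubound; exists C. Qed.

Lemma inner_content_le U a :
  (forall C, closed C -> C `<=` U -> (m C)%:E <= a) -> inner_content U <= a.
Proof. by move=> h; apply: ge_ereal_sup => _ [C [cC CU] <-]; apply: h. Qed.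

Lemma inner_content_ge0 U : 0 <= inner_content U.
Proof.
apply: (@le_trans _ _ (m set0)%:E); first by rewrite lee_fin (mean_ge0 hm).
by apply: inner_content_ge; [exact: closed0|exact: sub0set].
Qed.

Lemma le_inner_content U V : U `<=` V -> inner_content U <= inner_content V.
Proof.
move=> UV; apply: inner_content_le => C cC CU.
by apply: inner_content_ge => //; apply: subset_trans UV.
Qed.

(** Normality separates the parts of [C] outside [U] and outside [V] by disjoint open sets. Removing
    one or the other from [C] leaves closed subsets of [U] and of [V] that together cover [C]. *)
Lemma inner_contentU U V : open U -> open V ->
  inner_content (U `|` V) <= inner_content U + inner_content V.
Proof.
move=> oU oV; apply: inner_content_le => C cC CUV.
have [| | |W1 [W2 [oW1 oW2 CW1 CW2 W12]]] := @normalX (C `\` U) (C `\` V).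
- by rewrite setDE; apply: closedI => //; apply: open_closedC.
- by rewrite setDE; apply: closedI => //; apply: open_closedC.
- by apply/seteqP; split=> x // [[/CUV[]? ? [? ?]]].
apply: (@le_trans _ _ ((m (C `\` W1))%:E + (m (C `\` W2))%:E)).
  rewrite -EFinD lee_fin; apply: le_trans (le_meanU hm _ _).
  apply: (le_mean hm) => x Cx; have [W1x|W1x] := pselect (W1 x); last by left.
  right; split=> // W2x.
  by have : (W1 `&` W2) x by []; rewrite W12.
apply: leeD; apply: inner_content_ge.
- by rewrite setDE; apply: closedI => //; apply: open_closedC.
- by move=> x [Cx W1x]; apply: contrapT => Ux; apply: W1x; apply: CW1.
- by rewrite setDE; apply: closedI => //; apply: open_closedC.
- by move=> x [Cx W2x]; apply: contrapT => Ux; apply: W2x; apply: CW2.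
Qed.

Lemma inner_content0 : inner_content set0 = 0.
Proof.
apply/eqP; rewrite eq_le inner_content_ge0 andbT.
apply: inner_content_le => C _; rewrite subset0 => ->.
by rewrite (mean_set0 hm).
Qed.

(** By compactness a closed subset of the union lies in finitely many of the sets, which leaves
    finite subadditivity. *)
Lemma inner_content_bigcup (U : (set X)^nat) : (forall n, open (U n)) ->
  inner_content (\bigcup_n U n) <= \sum_(n <oo) inner_content (U n).
Proof.
move=> oU; apply: inner_content_le => C cC CU.
have /compact_near_coveringP/(_ nat \oo (fun n x => (\big[setU/set0]_(k < n) U k) x)) : compact C.
  by apply: subclosed_compact cC X_compact _.
case=> [|N _ /(_ N (leqnn _)) CN].
  move=> x /CU[k _ Ukx]; exists (U k, [set n | (k < n)%N]).
    split; first by apply: open_nbhs_nbhs; split => //; apply: oU.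
    by exists k.+1.
  by move=> [y n] [/= Uky kn]; rewrite -bigcup_mkord; exists k.
apply: le_trans (inner_content_ge cC CN) _.
apply: le_trans _ (nneseries_lim_ge N _); last first.
  by move=> n _ _; apply: inner_content_ge0.
rewrite big_mkord; elim: N {CN} => [|N IH]; first by rewrite !big_ord0 inner_content0.
rewrite !big_ord_recr /=; apply: le_trans (inner_contentU _ (oU _)) _.
  by rewrite -bigcup_mkord; apply: bigcup_open => i _.
exact: leeD2r.
Qed.

Lemma outer_content_open U : open U -> outer_content U = inner_content U.
Proof.
move=> oU; apply/eqP; rewrite eq_le; apply/andP; split.
  by apply: ge_ereal_inf; exists (inner_content U) => //; exists U => //; split.
by apply: le_ereal_inf_tmp => _ [V [oV UV] <-]; apply: le_inner_content.
Qed.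

Lemma outer_content_le A U : open U -> A `<=` U ->
  outer_content A <= inner_content U.
Proof. by move=> oU AU; apply: ge_ereal_inf; exists (inner_content U) => //; exists U => //; split. Qed.

Lemma outer_content_set0 : outer_content set0 = 0.
Proof. by rewrite outer_content_open ?inner_content0//; apply: open0. Qed.

Lemma outer_content_ge0 A : 0 <= outer_content A.
Proof. by apply: le_ereal_inf_tmp => _ [V _ <-]; apply: inner_content_ge0. Qed.

Lemma le_outer_content : {homo outer_content : A B / A `<=` B >-> A <= B}.
Proof.
move=> A B AB; apply: le_ereal_inf_tmp => _ [V [oV BV] <-].
by apply: outer_content_le => //; apply: subset_trans BV.
Qed.

Lemma outer_content_fin A : outer_content A \is a fin_num.
Proof.
apply/fin_numPlt/andP; split; first exact: lt_le_trans (outer_content_ge0 A).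
apply: (@le_lt_trans _ _ 1%:E); last exact: ltry.
apply: le_trans (outer_content_le openT (@subsetT _ _)) _.
by apply: inner_content_le => C _ _; rewrite lee_fin (mean_le1 hm).
Qed.

Lemma outer_content_sigma_subadditive : sigma_subadditive outer_content.
Proof.
move=> A; apply/lee_addgt0Pr => e e0.
have hex n : exists U : set X, [/\ open U, A n `<=` U &
    inner_content U <= outer_content (A n) + (e / (2 ^ n.+1)%:R)%:E].
  have d0 : (0 < e / (2 ^ n.+1)%:R)%R by rewrite divr_gt0// ltr0n expn_gt0.
  have [_ [U [oU AU] <-] hU] := lb_ereal_inf_adherent d0 (outer_content_fin (A n)).
  by exists U; split=> //; apply: ltW.
have [U hU] := choice hex.
apply: le_trans (epsilon_trick _ _ (ltW e0)); last first.
  by move=> n; apply: outer_content_ge0.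
apply: (@le_trans _ _ (inner_content (\bigcup_n U n))).
  apply: outer_content_le; first by apply: bigcup_open => n _; have [] := hU n.
  by move=> x [n _ Anx]; exists n => //; have [_ + _] := hU n; apply.
apply: le_trans (inner_content_bigcup _) _; first by move=> n; have [] := hU n.
apply: lee_nneseries => n *; first exact: inner_content_ge0.
by have [] := hU n.
Qed.

HB.instance Definition _ := isOuterMeasure.Build R X outer_content
  outer_content_set0 outer_content_ge0 le_outer_content
  outer_content_sigma_subadditive.

(** It suffices to cut open sets [U]. Exhaust the part of [U] in [O] from inside by closed sets [C],
    then the open rest of [U] outside [C], which contains the part outside [O], by closed sets [C'].
    As [C] and [C'] are disjoint, [m] adds up on their union. *)
Lemma open_caratheodory (O : set X) : open O -> outer_content.-caratheodory O.
Proof.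
move=> oO; apply: le_caratheodory_measurable => A.
apply: le_ereal_inf_tmp => _ [U [oU AU] <-].
apply: (@le_trans _ _ (inner_content (U `&` O) + outer_content (U `&` ~` O))).
  apply: leeD; last by apply: le_outer_content; apply: setSI.
  by apply: outer_content_le; [exact: openI|exact: setSI].
have fin : outer_content (U `&` ~` O) \is a fin_num by exact: outer_content_fin.
rewrite -leeBrDr//; apply: inner_content_le => C cC CUO.
rewrite leeBrDr//.
apply: (@le_trans _ _ ((m C)%:E + inner_content (U `\` C))).
  rewrite leeD2l// outer_content_le//; first by rewrite setDE; apply: openI => //; exact: closed_openC.
  by move=> x [Ux nOx]; split=> // /CUO[].
rewrite addeC -leeBrDr//; apply: inner_content_le => C' cC' C'U.
rewrite leeBrDr// -EFinD -(meanU hm).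
  by apply: inner_content_ge; [exact: closedU|move=> x [/C'U|/CUO] []].
by apply/seteqP; split=> x // [/C'U[]].
Qed.

Lemma preimage_act g (A : set X) : act g @` A = act g^-1%g @^-1` A.
Proof.
have [[act1 actM] _] := act_homeo.
apply/seteqP; split=> [_ [x Ax <-]|x /= Ax]; first by rewrite /= -actM mulVg act1.
by exists (act g^-1%g x) => //; rewrite -actM mulgV act1.
Qed.

Lemma inner_content_act g U : inner_content (act g @^-1` U) = inner_content U.
Proof.
have [[act1 actM] act_cont] := act_homeo.
have le h V : inner_content V <= inner_content (act h @^-1` V).
  apply: inner_content_le => C cC CV; rewrite -(mean_translate hm h).
  apply: inner_content_ge; last by move=> x /CV.
  by apply: closed_comp => // x _; apply: act_cont.
apply/eqP; rewrite eq_le le andbT; apply: le_trans (le g^-1%g _) _.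
rewrite -comp_preimage (_ : _ \o _ = id)//.
by apply/funext => x /=; rewrite -actM mulgV act1.
Qed.

Lemma outer_content_act g A : outer_content (act g @` A) = outer_content A.
Proof.
have [[act1 actM] act_cont] := act_homeo.
have le h B : outer_content (act h @^-1` B) <= outer_content B.
  apply: le_ereal_inf_tmp => _ [V [oV BV] <-]; rewrite -(inner_content_act h).
  apply: outer_content_le; last by move=> x /BV.
  by apply: open_comp => // x _; apply: act_cont.
rewrite preimage_act; apply/eqP; rewrite eq_le le/=.
apply: le_trans (le g _); rewrite -comp_preimage (_ : _ \o _ = id)//.
by apply/funext => x /=; rewrite -actM mulVg act1.
Qed.

Lemma outer_content_setT : outer_content setT = 1.
Proof.
rewrite outer_content_open; last exact: openT.
apply/eqP; rewrite eq_le; apply/andP; split.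
  by apply: inner_content_le => C _ _; rewrite lee_fin (mean_le1 hm).
by rewrite -(mean_setT hm); apply: inner_content_ge => //; exact: closedT.
Qed.

Variable x0 : X.

Definition mean_measure (A : set (borel_space x0)) : \bar R := outer_content A.

Let mean_measure0 : mean_measure set0 = 0.
Proof. exact: outer_content_set0. Qed.

Let mean_measure_ge0 A : 0 <= mean_measure A.
Proof. exact: outer_content_ge0. Qed.

Let borel_caratheodory (A : set X) :
  measurable (A : set (borel_space x0)) -> outer_content.-caratheodory A.
Proof.
pose cT := caratheodory_type (T := pointed_at x0) outer_content.
have [s0 sC sU] : sigma_algebra [set: cT] (@measurable _ cT) := sigma_algebra_measurable _.
apply: (smallest_sub (C := sigma_algebra setT)).
  exact: (@sigma_algebra_measurable _ cT).
by move=> O oO; apply: open_caratheodory.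
Qed.

Let mean_measure_sigma_additive : semi_sigma_additive mean_measure.
Proof.
move=> A mA tA mUA.
apply: (@caratheodory_measure_sigma_additive R (pointed_at x0) outer_content) => //.
  by move=> i; apply: borel_caratheodory.
exact: borel_caratheodory.
Qed.

HB.instance Definition _ := isMeasure.Build _ (borel_space x0) R mean_measure
  mean_measure0 mean_measure_ge0 mean_measure_sigma_additive.

Let mean_measure_setT : mean_measure setT = 1.
Proof. exact: outer_content_setT. Qed.

HB.instance Definition _ := Measure_isProbability.Build _ (borel_space x0) R
  mean_measure mean_measure_setT.

Lemma mean_measure_invariant : invariant_measure act mean_measure.
Proof. by move=> g A _; apply: outer_content_act. Qed.

(** The hypothesis bears on neighbourhoods of [D] because an ultralimit of means that are large on
    shrinking neighbourhoods may be small on [D] itself. Normality inserts a closed set between a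
    neighbourhood [W1] of [D] and [U]. *)
Lemma mean_measure_closed_ge (D : set X) (r : R) : closed D ->
  (forall N, open N -> D `<=` N -> (r <= m N)%R) ->
  r%:E <= mean_measure D.
Proof.
move=> cD hr; apply: le_ereal_inf_tmp => _ [U [oU DU] <-].
have [| | |W1 [W2 [oW1 oW2 DW1 UW2 W12]]] := @normalX D (~` U) => //.
- exact: open_closedC.
- by apply/seteqP; split=> x // [/DU].
apply: (@le_trans _ _ (m W1)%:E); first by rewrite lee_fin hr.
apply: (@le_trans _ _ (m (~` W2))%:E).
  rewrite lee_fin; apply: (le_mean hm) => x W1x W2x.
  by have : (W1 `&` W2) x by []; rewrite W12.
apply: inner_content_ge; first exact: open_closedC.
by move=> x W2x; apply: contrapT => Ux; apply: W2x; apply: UW2.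
Qed.

(** The subadditivity clause is inherited from the outer measure, so it holds for arbitrary sets. *)
Lemma invariant_measure_of_mean :
  exists mu : probability (borel_space x0) R,
  [/\ invariant_measure act mu,
      forall (J : finType) (B : J -> set X) (C : set X),
        mu (\bigcup_j B j `|` C) <= \sum_j mu (B j) + mu C
    & forall (D : set X) (r : R), closed D ->
        (forall N, open N -> D `<=` N -> (r <= m N)%R) -> r%:E <= mu D].
Proof.
exists mean_measure; split=> [|J B C|].
- exact: mean_measure_invariant.
- apply: le_trans (outer_measureU2 outer_content _ _) _.
  apply: leeD => //; exact: (outer_measure_bigcup_finType outer_content).
- exact: mean_measure_closed_ge.
Qed.

End MeasureOfMean.

(** * Fuzzy colourings *)

Section FuzzyColoring.
Context (R : realType) (G : groupType) (X : topologicalType).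
Variable act : G -> X -> X.

(* The point x is fully coloured where u x = 0 and uncoloured where u x >= 1; the
   junk value of c there is irrelevant. *)
Record fuzzy_coloring (E : {fset G}) (C : Type) (u : X -> R) (c : X -> C) :
    Prop := FuzzyColoring {
  fuzzy_continuous : continuous u;
  fuzzy_ge0 : forall x, 0 <= u x;
  fuzzy_loc : forall x, u x < 1 -> \forall y \near x, c y = c x;
  fuzzy_proper : forall x g, g \in E -> g != 1%g ->
    u x < 1 -> u (act g x) < 1 -> c x <> c (act g x) }.

Definition fuzzy_bound (u : X -> R) (b : R) :=
  forall m, invariant_mean act m -> m [set x | 0 < u x] <= b.

Lemma notin_boundary (A : set X) x : ~ boundary A x ->
  nbhs x A \/ nbhs x (~` A).
Proof.
move=> h; have [|nA] := pselect (interior A x); first by left.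
right; change (interior (~` A) x); rewrite interiorC => cA.
by apply: h.
Qed.

Lemma closed_boundary (A : set X) : closed (boundary A).
Proof.
apply: closedI; first exact: closed_closure.
exact: open_closedC (@open_interior _ _).
Qed.

Hypothesis X_compact : compact [set: X].
Hypothesis X_hausdorff : hausdorff_space X.
Hypothesis act_homeo : action_by_homeo act.
Hypothesis act_FCSB : FCSB_in_measure R act.

(** A point is coloured by an index [i] with the point in [U i]; off the closed set [D] all
    memberships are locally constant. The function [u] is a Urysohn function, [1] on [D] and [0] off
    a neighbourhood [N] of [D], so it is [N] that must be small for every mean. *)
Lemma initial_fuzzy_coloring (E : {fset G}) (b : R) : 0 < b ->
  exists n u (c : X -> option 'I_n), fuzzy_coloring E u c /\ fuzzy_bound u b.
Proof.
move=> b0; have [n [U [hU muU]]] := act_FCSB (1%g |` E)%fset b0.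
pose D := \bigcup_i boundary (U i) `|` ~` \bigcup_i U i.
have cD : closed D.
  apply: closedU.
    by apply: closed_bigcup => [|i _]; [exact: finite_finset|exact: closed_boundary].
  by apply: open_closedC; apply: bigcup_open => i _; have [] := hU i.
(* Otherwise the ultralimit of counterexamples along the neighbourhoods of D
   yields an invariant measure violating FCSB. *)
have [N [oN DN hN]] : exists N, [/\ open N, D `<=` N &
    forall m : set X -> R, invariant_mean act m -> m N < b].
  apply: contrapT => nN.
  have hex N : exists m : set X -> R, open N -> D `<=` N ->
      invariant_mean act m /\ b <= m N.
    have [[oN DN]|h] := pselect (open N /\ D `<=` N); last first.
      by exists (fun=> 0) => ? ?; case: h.
    have /existsNP[m /not_implyP[hm /negP mN]] :
        ~ (forall m : set X -> R, invariant_mean act m -> m N < b).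
      by move=> h; apply: nN; exists N.
    by exists m => _ _; split=> //; rewrite leNgt.
  have [ms hms] := choice hex.
  pose I := {N : set X | open N /\ D `<=` N}.
  pose F : set_system I := fun P => exists N0 : I,
    forall N : I, sval N `<=` sval N0 -> P N.
  have FF : ProperFilter F.
    split=> [[N0 /(_ N0)]|]; first by apply.
    split=> [|P Q [N1 h1] [N2 h2]|P Q PQ [N1 h1]].
    - by exists (exist (fun N => open N /\ D `<=` N) setT (conj openT (@subsetT _ _))).
    - have oN : open (sval N1 `&` sval N2) /\ D `<=` sval N1 `&` sval N2.
        case: (svalP N1) => ? ?; case: (svalP N2) => ? ?.
        by split; [exact: openI|rewrite subsetI].
      exists (exist (fun N => open N /\ D `<=` N) _ oN) => N /= h; split.
        by apply: h1 => x /h[].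
      by apply: h2 => x /h[].
    - by exists N1 => N /h1 /PQ.
  have mean_ms (N : I) : invariant_mean act (ms (sval N)).
    by case: N => N [oN DN] /=; case: (hms N oN DN).
  have [||||m [hm mge]] := @mean_ultralimit R G X act I F FF (fun N => ms (sval N)).
  - by move=> N; exact: mean_setT (mean_ms N).
  - by move=> N A; exact: mean_ge0 (mean_ms N) A.
  - by move=> N A B; exact: meanU (mean_ms N) A B.
  - move=> g A e e0;
     exists (exist (fun N => open N /\ D `<=` N) setT
       (conj openT (@subsetT _ _))) => N _ /=.
    by rewrite (mean_translate (mean_ms N)) subrr normr0 ltW.
  (* The existence of a mean provides the base point that the measures require. *)
  have [x0 _] : [set: X] !=set0.
    apply/set0P/eqP => X0; have := mean_setT hm; rewrite X0 (mean_set0 hm).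
    by move/eqP; rewrite eq_sym oner_eq0.
  have [mu [mu_inv muU2 mu_ge]] :=
    invariant_measure_of_mean X_compact X_hausdorff act_homeo hm x0.
  have /= := muU x0 mu mu_inv.
  apply/negP; rewrite -leNgt.
  apply: le_trans (muU2 _ (fun i => boundary (U i)) (~` \bigcup_i U i)).
  apply: mu_ge => // N oN DN; apply: mge.
  exists (exist (fun N => open N /\ D `<=` N) N (conj oN DN)) => N' /= N'N.
  apply: le_trans (le_mean (mean_ms N') N'N).
  by case: N' {N'N} => N' [oN' DN'] /=; case: (hms N' oN' DN').
have normalX := (@normal_separatorP R X).1 (compact_normal X_hausdorff X_compact).
have ND0 : ~` N `&` D = set0 by apply/seteqP; split=> x // [] nNx /DN.
have [f [cf f01 fN fD]] := (@uniform_separatorP X R (~` N) D).1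
  (@normalX (~` N) D (open_closedC oN) cD ND0).
have f0 x : 0 <= f x.
  have : `[0, 1]%classic (f x) by apply: f01; exists x.
  by rewrite /= in_itv/= => /andP[].

have f1D x : f x < 1 -> ~ D x.
  by move=> fx Dx; move: fx; have -> := fD (f x) (ex_intro2 _ _ x Dx erefl); rewrite ltxx.
have locU x i : ~ D x -> \forall y \near x, `[< U i y >] = `[< U i x >].
  move=> nDx; have nb : ~ boundary (U i) x by move=> bx; apply: nDx; left; exists i.
  have [hx|hx] := notin_boundary nb; have Ux := nbhs_singleton hx.
    by apply: filterS hx => y Uy; rewrite !asboolT.
  by apply: filterS hx => y Uy; rewrite !asboolF.
pose c x := [pick i | `[< U i x >]].
exists n, f, c; split; last first.
  move=> m hm; apply: ltW; apply: le_lt_trans (hN m hm); apply: (le_mean hm) => x /= fx.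
  apply: contrapT => nNx; move: fx.
  by have -> := fN (f x) (ex_intro2 _ _ x nNx erefl); rewrite ltxx.
split=> // [x /f1D nDx|x g gE g1 fx fgx cx].
  have : \forall y \near x, forall i, `[< U i y >] = `[< U i x >].
    by apply: filter_forall => i; apply: locU.
  by apply: filterS => y hy; rewrite /c; apply: eq_pick => i; rewrite hy.
(* Off [D] some [U i] contains [x], so [x] and [act g x] cannot share the colour [None]. *)
have [i _ Uix] : (\bigcup_i U i) x.
  by apply: contrapT => h; apply: (f1D _ fx); right.
move: cx; rewrite /c; case: pickP => [j /asboolP Ujx|/(_ i)/asboolP//].
case: pickP => // k /asboolP Uk [jk]; rewrite -{k}jk in Uk.
have [_ /(_ g 1%g)] := hU j; move/eqP: g1 => + h; apply; apply: h.
- by rewrite /= !inE gE orbT.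
- by rewrite /= !inE eqxx.
- exists (act g x); split; first by exists x.
  by exists (act g x) => //; have [[-> _] _] := act_homeo.
Qed.

End FuzzyColoring.

(** * Colour reduction *)

Section Bump.
Context (R : realType).

(** For [a <= b] this is one minus four times the distance from [t] to [[a, b]], cut off at [0];
    with [b = t] it is a ramp equal to [1] from [a] on. The radius [1/4] keeps bumps around distinct
    integers disjoint. *)
Definition bump (a b t : R) := Num.max 0 (1 - 4 * Num.max 0 (Num.max (a - t) (t - b))).

Lemma bump_ge0 a b t : 0 <= bump a b t.
Proof. by rewrite /bump le_max lexx. Qed.

Lemma bump1 a b t : a <= t <= b -> bump a b t = 1.
Proof.
move=> /andP[h1 h2]; rewrite /bump (@max_l _ _ 0 (Num.max _ _)).
  by rewrite mulr0 subr0 max_r.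
by rewrite ge_max !subr_le0 h1.
Qed.

Lemma bump_gt0 a b t : 0 < bump a b t -> a - 1/4 < t < b + 1/4.
Proof.
rewrite /bump lt_max ltxx/= => h; apply/andP; split.
  have : a - t <= Num.max 0 (Num.max (a - t) (t - b)) by rewrite !le_max lexx orbT.
  by move: (Num.max _ _) h => z; lra.
have : t - b <= Num.max 0 (Num.max (a - t) (t - b)) by rewrite !le_max lexx !orbT.
by move: (Num.max _ _) h => z; lra.
Qed.

Lemma continuous_bump (X : topologicalType) (a b t : X -> R) :
  continuous a -> continuous b -> continuous t ->
  continuous (fun x => bump (a x) (b x) (t x)).
Proof.
move=> ca cb ct x.
apply: (@continuous_max R X (cst 0)
   (fun x => 1 - 4 * Num.max 0 (Num.max (a x - t x) (t x - b x))));
   first exact: cvg_cst.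
apply: cvgB; first exact: cvg_cst.
apply: cvgM; first exact: cvg_cst.
apply: (@continuous_max R X (cst 0) (fun x => Num.max (a x - t x) (t x - b x))); first exact: cvg_cst.
apply: (@continuous_max R X (fun x => a x - t x) (fun x => t x - b x)).
  by apply: cvgB; [exact: ca|exact: ct].
by apply: cvgB; [exact: ct|exact: cb].
Qed.

End Bump.

Lemma continuous_sum_fin (R : realType) (X : topologicalType) (J : finType)
    (f : J -> X -> R) :
  (forall j, continuous (f j)) -> continuous (fun x => \sum_j f j x).
Proof.
move=> cf; elim: (index_enum J) => [|j s IH] x.
  rewrite (_ : (fun x => _) = cst 0); first exact: cvg_cst.
  by apply/funext => y; rewrite big_nil.
rewrite (_ : (fun x => _) = f j \+ (fun x => \sum_(i <- s) f i x)).
  by apply: cvgD; [exact: cf|exact: IH].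
by apply/funext => y; rewrite big_cons.
Qed.

Section ColorReduction.
Context (R : realType) (G : groupType) (X : topologicalType).
Variable act : G -> X -> X.
Hypothesis act_homeo : action_by_homeo act.
Variable E : {fset G}.

(** The list [l] starts with [1], whence the successor: with [l 0 = 1] the switching values include
    the band edges of the point itself. *)
Let r := (#|` E|).+1.
Let l (i : nat) : G := nth 1%g (1%g :: enum_fset E) i.

Let l_onto g : g \in E -> exists i : 'I_r, l i = g.
Proof.
move=> gE; have h : ((index g (enum_fset E)).+1 < r)%N by rewrite ltnS index_mem.
by exists (Ordinal h); rewrite /l /= nth_index.
Qed.

Section Step.
Variables (b K' : nat) (u : X -> R) (c : X -> {ffun 'I_b.+1 -> bool}).
Hypothesis uc : fuzzy_coloring act E u c.
Let K := K'.+1.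

(* U = (K + 1) r u runs over K bands [k r, (k + 1) r[; points of distinct bands
   get disjoint sets of new colours, so proper colouring is only an issue inside
   a band. A point v of band k takes l_i v into account iff
   U (l_i v) < (k + 1) r + i: this includes all of band k, and l_i^-1 y is the only
   point whose decision about y switches at the value (k + 1) r + i of U y, when y
   is safely inside band k + 1. The new u' is 1 at the switching values and
   for U >= K r. *)
Let U (x : X) : R := (K.+1 * r)%:R * u x.

Let term (p : 'I_K * 'I_r) v :=
  bump (p.1 * r)%:R (p.1.+1 * r)%:R (U v) *
  bump (p.1.+1 * r + p.2)%:R (p.1.+1 * r + p.2)%:R (U (act (l p.2) v)).

Let u' v := bump (K * r)%:R (U v) (U v) + \sum_p term p v.

Let palette v := Num.truncn (U v / r%:R).

Let compare (i : 'I_r) v : 'I_b.+1 * bool :=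
  let p := if U (act (l i) v) < ((palette v).+1 * r + i)%:R then
    odflt ord0 [pick p | c v p != c (act (l i) v) p] else ord0 in
  (p, c v p).

Let c' v : 'I_K * {ffun 'I_r -> 'I_b.+1 * bool} :=
  (inord (palette v), [ffun i => compare i v]).

Let U_continuous : continuous U.
Proof. by move=> x; apply: cvgM; [exact: cvg_cst|exact: (fuzzy_continuous uc)]. Qed.

Let act_continuous g : continuous (act g).
Proof. by have [_ h] := act_homeo; apply: h. Qed.

Let Uact_continuous g : continuous (fun x => U (act g x)).
Proof.
move=> x; apply: (@continuous_comp _ _ _ (act g) U); first exact: act_continuous.
exact: U_continuous.
Qed.

Let U_ge0 v : 0 <= U v.
Proof. by rewrite mulr_ge0// (fuzzy_ge0 uc). Qed.

Let U_lt v : U v < (K.+1 * r)%:R -> u v < 1.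
Proof. by rewrite /U gtr_pMr// ltr0n. Qed.

Let term_ge0 p v : 0 <= term p v.
Proof. by rewrite mulr_ge0// bump_ge0. Qed.

Let term_le p v : term p v <= u' v.
Proof.
rewrite /u' (bigD1 p)//= addrCA lerDl addr_ge0 ?bump_ge0//.
by apply: sumr_ge0 => q _; apply: term_ge0.
Qed.

Let palette_itv v : (palette v * r)%:R <= U v < ((palette v).+1 * r)%:R.
Proof.
have /andP[h1 h2] : (palette v)%:R <= U v / r%:R < (palette v).+1%:R.
  by rewrite truncn_itv// divr_ge0.
by rewrite !natrM -ler_pdivlMr ?ltr0n// h1 -ltr_pdivrMr ?ltr0n.
Qed.

Let paletteE v k : (k * r)%:R <= U v < (k.+1 * r)%:R -> palette v = k.
Proof.
move=> /andP[h1 h2]; apply/eqP; rewrite /palette truncn_eq ?divr_ge0//.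
by rewrite ler_pdivlMr ?ltr0n// -natrM h1 ltr_pdivrMr ?ltr0n// -natrM.
Qed.

Let palette_lt v : u' v < 1 -> (palette v < K)%N.
Proof.
move=> uv; have UK : U v < (K * r)%:R.
  rewrite ltNge; apply/negP => h; move: uv; apply/negP; rewrite -leNgt /u'.
  rewrite bump1 ?h ?lexx// lerDl; apply: sumr_ge0 => p _; exact: term_ge0.
have /andP[h _] := palette_itv v.
by have := le_lt_trans h UK; rewrite ltr_nat ltn_pmul2r.
Qed.

(** Otherwise [U v] is the upper edge of the band below, where the term for [l 0 = 1] equals [1]. *)
Let palette_gt v : u' v < 1 -> (0 < palette v)%N -> (palette v * r)%:R < U v.
Proof.
move=> uv p0; have /andP[h h'] := palette_itv v.
rewrite lt_neqAle h andbT; apply/negP => /eqP e.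
have pK := palette_lt uv.
have kK : ((palette v).-1 < K)%N by apply: leq_ltn_trans pK; exact: leq_pred.
have := term_le (Ordinal kK, ord0) v; rewrite leNgt => /negP; apply.
apply: lt_le_trans uv _; rewrite /term /= prednK// /l /= addn0.
have [[-> _] _] := act_homeo; rewrite !bump1 ?mulr1// -e lexx ?andbT//.
by rewrite ler_nat leq_mul2r leq_pred orbT.
Qed.

Let threshold_neq v (i : 'I_r) : u' v < 1 ->
  U (act (l i) v) != ((palette v).+1 * r + i)%:R.
Proof.
move=> uv; apply/negP => /eqP e; have pK := palette_lt uv.
have := term_le (Ordinal pK, i) v; rewrite leNgt => /negP; apply.
apply: lt_le_trans uv _; rewrite /term /= e !bump1 ?mulr1 ?lexx//.
by have /andP[-> /ltW ->] := palette_itv v.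
Qed.

(** The last band is [K - 1] and [i < r], so switching values stay below [(K + 1) r]. Scaling [u] by
    one band more than is used thus ensures that every point taken into account is coloured by
    [c]. *)
Let threshold_lt v (i : 'I_r) : u' v < 1 ->
  U (act (l i) v) < ((palette v).+1 * r + i)%:R -> u (act (l i) v) < 1.
Proof.
move=> uv h; apply: U_lt; apply: lt_le_trans h _; rewrite ler_nat.
have := palette_lt uv; have := ltn_ord i.
move=> ir pK; apply: (@leq_trans (K * r + r)).
  by apply: leq_add; [rewrite leq_mul2r pK orbT|exact: ltnW].
by rewrite mulSn addnC.
Qed.

Let u'_lt v : u' v < 1 -> u v < 1.
Proof.
move=> uv; apply: U_lt; have /andP[_ h] := palette_itv v.
apply: lt_trans h _; rewrite ltr_nat ltn_pmul2r// ltnS.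
exact: palette_lt.
Qed.

(** Where [u' v < 1], no value of [U] that is consulted sits on a positive lower band edge or on a
    switching value, so the comparisons persist nearby. The old colours that are read are locally
    constant. *)
Let c'_loc v : u' v < 1 -> \forall y \near v, c' y = c' v.
Proof.
move=> uv.
have near_palette : \forall y \near v, palette y = palette v.
  have /andP[_ h2] := palette_itv v.
  have near2 : \forall y \near v, U y < ((palette v).+1 * r)%:R.
    by apply: (cvgr_lt (U v)) => //; exact: U_continuous.
  case: (posnP (palette v)) => [p0|p0].
    apply: filterS near2 => y Uy; apply: paletteE.
    by rewrite Uy andbT p0 mul0n.
  have near1 : \forall y \near v, (palette v * r)%:R < U y.
    by apply: (cvgr_gt (U v)); [exact: U_continuous|exact: palette_gt].
  by apply: filterS2 near1 near2 => y h1 h2'; apply: paletteE; rewrite (ltW h1).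
have near_compare (i : 'I_r) : \forall y \near v,
    (U (act (l i) y) < ((palette v).+1 * r + i)%:R) =
      (U (act (l i) v) < ((palette v).+1 * r + i)%:R) /\
    (U (act (l i) v) < ((palette v).+1 * r + i)%:R ->
      c (act (l i) y) = c (act (l i) v)).
  have [h|h] := ltP (U (act (l i) v)) ((palette v).+1 * r + i)%:R.
    have near1 : \forall y \near v, U (act (l i) y) < ((palette v).+1 * r + i)%:R.
      by apply: (cvgr_lt (U (act (l i) v))) => //; exact: Uact_continuous.
    have near2 : \forall y \near v, c (act (l i) y) = c (act (l i) v).
      exact: (@act_continuous (l i) v _ (fuzzy_loc uc (threshold_lt uv h))).
    by apply: filterS2 near1 near2 => y -> ->.
  have {}h : ((palette v).+1 * r + i)%:R < U (act (l i) v).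
    by rewrite lt_neqAle eq_sym threshold_neq.
  have : \forall y \near v, ((palette v).+1 * r + i)%:R < U (act (l i) y).
    by apply: (cvgr_gt (U (act (l i) v))) => //; exact: Uact_continuous.
  by apply: filterS => y hy; split=> //; apply/negbTE; rewrite -leNgt ltW.
have := fuzzy_loc uc (u'_lt uv).
apply: filterS3 near_palette (filter_forall _ near_compare) => y py cy ccy.
rewrite /c' py; congr pair; apply/ffunP => i; rewrite !ffunE /compare py ccy.
by have [-> h] := cy i; case: ifPn => // /h ->.
Qed.

(** Cole-Vishkin argument. Equal new colours put [v] and [act g v] in one band, so [v] takes
    [act g v = act (l i) v] into account. Equality of the entries [i] then makes the old colours
    agree at the very bit where [v] recorded a difference. *)
Let c'_proper v g : g \in E -> g != 1%g -> u' v < 1 -> u' (act g v) < 1 ->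
  c' v <> c' (act g v).
Proof.
move=> gE g1 uv ugv [pp cc]; have [i li] := l_onto gE.
have pE : palette v = palette (act g v).
  by have := congr1 val pp; rewrite /= !inordK// ?ltnS; apply: palette_lt.
move/ffunP/(_ i): cc; rewrite !ffunE /compare -pE li.
have -> : U (act g v) < ((palette v).+1 * r + i)%:R.
  rewrite pE; have /andP[_ h] := palette_itv (act g v).
  by apply: lt_le_trans h _; rewrite ler_nat leq_addr.
case: pickP => [p /= cp [<-] /eqP|h _] /=; first by rewrite (negbTE cp).
apply: (fuzzy_proper uc gE g1 (u'_lt uv) (u'_lt ugv)); apply/ffunP => p.
by have /negbFE/eqP := h p.
Qed.

Let reduced_coloring : fuzzy_coloring act E u' c'.
Proof.
split; [|by move=> v; rewrite addr_ge0 ?bump_ge0// sumr_ge0|exact: c'_loc|exact: c'_proper].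
have cont_ramp : continuous (fun v => bump (K * r)%:R (U v) (U v)).
  exact: (continuous_bump (@cst_continuous _ _ _) U_continuous U_continuous).
have cont_term p : continuous (term p).
  move=> x; apply: cvgM.
    exact: (continuous_bump (@cst_continuous _ _ _) (@cst_continuous _ _ _) U_continuous).
  exact: (continuous_bump (@cst_continuous _ _ _) (@cst_continuous _ _ _) (@Uact_continuous _)).
by move=> x; apply: cvgD; [exact: cont_ramp|exact: (continuous_sum_fin cont_term)].
Qed.

Section Bound.
Variables (m : set X -> R).
Hypothesis hm : invariant_mean act m.

Let slice q : set X := [set v | q%:R - 1/4 < U v < q%:R + 1/4].

Let slice_inj p q v : slice p v -> slice q v -> p = q.
Proof.
move=> /andP[p1 p2] /andP[q1 q2]; apply/eqP; rewrite eqn_leq.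
apply/andP; split.
  by rewrite -ltnS -(ltr_nat R) -natr1; lra.
by rewrite -ltnS -(ltr_nat R) -natr1; lra.
Qed.

Let U_gt0 v : 0 < U v -> 0 < u v.
Proof. by rewrite /U pmulr_rgt0// ltr0n. Qed.

Let index_inj (k k' : nat) (i i' : 'I_r) :
  (k.+1 * r + i = k'.+1 * r + i')%N -> (k, i) = (k', i').
Proof.
move=> e; have := congr1 (divn^~ r) e; rewrite !divnMDl// !divn_small// !addn0 => -[->].
by have := congr1 (modn^~ r) e; rewrite !modnMDl !modn_small// => /val_inj ->.
Qed.

Let layer k := \sum_(i < r) m (slice (k.+1 * r + i)).

Let layer_bound : \sum_(k < K) layer k <= m [set v | 0 < u v].
Proof.
rewrite /layer pair_big /=; apply: (sum_mean_le hm) => [[k i]|[k i] [k' i'] v] /=.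
  move=> v /andP[h _]; apply: U_gt0; apply: le_lt_trans h; rewrite subr_ge0.
  apply: (@le_trans _ _ 1); first by lra.
  by rewrite ler1n mulSn.
by move=> h h'; have [/val_inj -> ->] := index_inj (slice_inj h h').
Qed.

(* A point v whose new colour is ambiguous is charged to the l_i v causing the
   ambiguity when v lies in a band below j + 1, and to itself otherwise. Only points
   in band j + 1 are charged twice, and summing over j they number at most
   m {u > 0}. *)
Let u'_bound (j : 'I_K) :
  m [set v | 0 < u' v] <= m [set v | 0 < u v] + layer j.
Proof.
pose top := [set v | (j.+1 * r)%:R - 1/4 < U v].
pose S (p : option ('I_j * 'I_r)) : set X :=
  if p is Some (k, i) then slice (k.+1 * r + i) else top.
have rj : (1 : R) <= (j.+1 * r)%:R by rewrite ler1n mulSn.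
have S_bound : \sum_p m (S p) <= m [set v | 0 < u v].
  apply: (sum_mean_le hm) => [[[k i]|]|].
  - move=> v /andP[h _]; apply: U_gt0; apply: le_lt_trans h; rewrite subr_ge0.
    apply: (@le_trans _ _ 1); first by lra.
    by rewrite ler1n mulSn.
  - by move=> v; rewrite /S /top /= => h; apply: U_gt0; lra.
  - have top_slice (k : 'I_j) (i : 'I_r) v : slice (k.+1 * r + i) v -> ~ top v.
      move=> /andP[_ h1]; rewrite /top /= => h2.
      have : (k.+1 * r + i).+1%:R <= (j.+1 * r)%:R :> R.
        rewrite ler_nat; apply: (@leq_trans (k.+1 * r + r)).
          by rewrite -addnS leq_add2l.
        by rewrite -mulSnr leq_mul2r ltnS (ltn_ord k) orbT.
      by rewrite -natr1; lra.
    move=> [[k i]|] [[k' i']|] v //=; last 2 first.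
    - by move=> /top_slice.
    - by move=> h /top_slice.
    by move=> h h'; have [/val_inj -> ->] := index_inj (slice_inj h h').
(* By invariance the sets [T] have the means of the disjoint sets [S], followed by those of the
   slices in [layer j]. *)
pose T (p : option ('I_j * 'I_r) + 'I_r) : set X :=
  match p with
  | inl (Some (k, i)) => act (l i) @^-1` slice (k.+1 * r + i)
  | inl None => top
  | inr i => act (l i) @^-1` slice (j.+1 * r + i)
  end.
apply: (@le_trans _ _ (\sum_p m (T p))).
  apply: (le_mean_bigcup hm) => v /= u'v.
  have [tv|/negP ntv] := boolP ((j.+1 * r)%:R - 1/4 < U v); first by exists (inl None).
  have ramp0 : bump (K * r)%:R (U v) (U v) <= 0.
    rewrite leNgt; apply/negP => /bump_gt0 /andP[h _]; apply: ntv.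
    apply: le_lt_trans h; rewrite lerD2r ler_nat leq_mul2r.
    by rewrite (ltn_ord j) orbT.
  have [[k i] hki] : exists p, 0 < term p v.
    apply: contrapT => /forallNP h; move: u'v; rewrite ltNge => /negP; apply.
    rewrite /u' -[leRHS]addr0 lerD//; apply: sumr_le0 => p _.
    by rewrite leNgt; apply/negP/h.
  have b1 : 0 < bump (k * r)%:R (k.+1 * r)%:R (U v).
    rewrite lt_neqAle bump_ge0 andbT eq_sym; apply/negP => /eqP h.
    by move: hki; rewrite /term /= h mul0r ltxx.
  have b2 : 0 < bump (k.+1 * r + i)%:R (k.+1 * r + i)%:R (U (act (l i) v)).
    rewrite lt_neqAle bump_ge0 andbT eq_sym; apply/negP => /eqP h.
    by move: hki; rewrite /term /= h mulr0 ltxx.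
  have {}b2 := bump_gt0 b2.
  have kj : (k <= j)%N.
    rewrite leqNgt; apply/negP => jk; apply: ntv.
    have /andP[h _] := bump_gt0 b1; apply: le_lt_trans h.
    by rewrite lerD2r ler_nat leq_mul2r jk orbT.
  move: kj; rewrite leq_eqVlt => /orP[/eqP kj|kj].
    by exists (inr i) => //; rewrite /T -kj.
  by exists (inl (Some (Ordinal kj, i))).
rewrite big_sumType /= lerD//.
  apply: le_trans S_bound; apply: ler_sum => -[[k i]|] _ //=.
  by rewrite (mean_translate hm).
by apply: ler_sum => i _; rewrite (mean_translate hm).
Qed.

(** Average [u'_bound] over the [K] values of [j]; the layers are disjoint, so together they cost
    only one more copy of the right-hand mean. *)
Lemma reduced_bound :
  m [set v | 0 < u' v] <= (1 + K%:R^-1) * m [set v | 0 < u v].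
Proof.
have K0 : (0 : R) < K%:R by rewrite ltr0n.
rewrite -(ler_pM2l K0) mulrA mulrDr mulr1 mulfV ?gt_eqF// mulrDl mul1r.
apply: le_trans (_ : \sum_(j < K) (m [set v | 0 < u v] + layer j) <= _).
  apply: (@le_trans _ _ (\sum_(j < K) m [set v | 0 < u' v])).
    by rewrite sumr_const card_ord mulr_natl.
  by apply: ler_sum => j _; apply: u'_bound.
by rewrite big_split /= sumr_const card_ord mulr_natl lerD2l layer_bound.
Qed.

End Bound.

Lemma color_reduction :
  exists (u1 : X -> R) (c1 : X -> 'I_K * {ffun 'I_r -> 'I_b.+1 * bool}),
    fuzzy_coloring act E u1 c1 /\
    forall m : set X -> R, invariant_mean act m ->
      m [set v | 0 < u1 v] <= (1 + K%:R^-1) * m [set v | 0 < u v].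
Proof.
by exists u', c'; split; [exact: reduced_coloring|exact: reduced_bound].
Qed.
End Step.
End ColorReduction.

(** * Reduction to a bounded number of colours *)

Lemma card_injection (C C' : finType) : (#|C| <= #|C'|)%N ->
  exists f : C -> C', injective f.
Proof.
move=> h; exists (fun x => enum_val (widen_ord h (enum_rank x))) => x y.
move=> /enum_val_inj /(congr1 val) /= e; apply: enum_rank_inj.
exact: val_inj.
Qed.

Lemma poly_le_exp2 r : exists2 b0, (0 < b0)%N &
  forall b, (b0 <= b)%N -> (b * b.+2 * (2 * b.+1) ^ r <= 2 ^ b)%N.
Proof.
(* The two extra factors in [s = r + 2] absorb [b (b + 2)]. With [q] the integer part of
   [(b + 1) / (2 s)], [2 (b + 1) <= 4 s (q + 1) <= 2 ^ (4 s + q)], and [b > 8 s^2] gives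
   [s (4 s + q) <= b]. *)
pose s := r.+2; exists (8 * s * s).+1 => // b hb.
have le2 n : (n.+1 <= 2 ^ n)%N by exact: ltn_expl.
pose q := (b.+1 %/ (2 * s))%N.
have qb : (q * (2 * s) <= b.+1)%N by exact: leq_trunc_div.
have bq : (b.+1 < q.+1 * (2 * s))%N by exact: ltn_ceil.
apply: (@leq_trans ((2 * b.+1) ^ s)).
  by rewrite /s !expnS mulnA leq_mul//; nia.
have h1 : (2 * b.+1 <= 2 ^ (4 * s) * 2 ^ q)%N.
  apply: (@leq_trans (4 * s * q.+1)); first by nia.
  by apply: leq_mul; [apply: ltnW; exact: le2|exact: le2].
apply: (@leq_trans ((2 ^ (4 * s) * 2 ^ q) ^ s)).
  by rewrite leq_exp2r.
by rewrite -expnD -expnM leq_exp2l//; nia.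
Qed.

Section BoundedColoring.
Context (R : realType) (G : groupType) (X : topologicalType).
Variable act : G -> X -> X.
Hypothesis act_homeo : action_by_homeo act.

Lemma fuzzy_recolor E (C C' : Type) (f : C -> C') u c : injective f ->
  fuzzy_coloring (R := R) act E u c -> fuzzy_coloring act E u (f \o c).
Proof.
move=> f_inj [cu u0 uloc uprop]; split=> // [x ux|x g gE g1 ux ugx /f_inj].
  by apply: filterS (uloc x ux) => y /= ->.
exact: uprop.
Qed.

Definition bit_coloring (E : {fset G}) (b : nat) (d : R) :=
  exists u (c : X -> {ffun 'I_b -> bool}),
    fuzzy_coloring act E u c /\ fuzzy_bound act u d.

Lemma bit_coloring_of (C : finType) E b (d : R) u (c : X -> C) :
  (#|C| <= 2 ^ b)%N -> fuzzy_coloring act E u c -> fuzzy_bound act u d ->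
  bit_coloring E b d.
Proof.
move=> Cb uc ud; have [|f f_inj] := @card_injection C {ffun 'I_b -> bool}.
  by rewrite card_ffun card_bool card_ord.
by exists u, (f \o c); split=> //; apply: fuzzy_recolor.
Qed.

Lemma bit_coloring_step E b (d : R) : (0 < b)%N ->
  (b * b.+2 * (2 * b.+1) ^ #|` E|.+1 <= 2 ^ b)%N ->
  bit_coloring E b.+1 d -> bit_coloring E b ((1 + (b * b.+2)%:R^-1) * d).
Proof.
move=> b0 hb [u [c [uc ud]]].
have Kb : (b * b.+2).-1.+1 = (b * b.+2)%N by rewrite prednK// muln_gt0 b0.
have [u1 [c1 [uc1 hu1]]] := color_reduction act_homeo (b * b.+2).-1 uc.
apply: (bit_coloring_of _ uc1).
  by rewrite card_prod card_ffun card_prod !card_ord card_bool Kb (mulnC b.+1).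
move=> m hm; apply: le_trans (hu1 m hm) _.
by rewrite Kb ler_wpM2l ?ud// addr_ge0.
Qed.

(** Bits are removed one at a time from a colouring with an uncontrolled number of colours. The
    process stops at a [b] chosen before [d], from the size of [E] alone. *)
Lemma bounded_coloring (X_compact : compact [set: X])
    (X_hausdorff : hausdorff_space X) (act_FCSB : FCSB_in_measure R act)
    (E : {fset G}) :
  exists b, forall d : R, 0 < d -> bit_coloring E b d.
Proof.
have [b0 b0_gt0 hb0] := poly_le_exp2 #|` E|.+1; exists b0 => d d0.
(* (1 + 1 / (b (b + 2))) (b + 2) / (b + 1) = (b + 1) / b, so the product of the
   losses telescopes and is at most 2. *)
have iter k (z : R) : bit_coloring E (b0 + k) (z * ((b0 + k).+1%:R / (b0 + k)%:R)) ->
    bit_coloring E b0 (z * (b0.+1%:R / b0%:R)).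
  elim: k => [|k IH]; first by rewrite addn0.
  rewrite addnS => /bit_coloring_step h; apply: IH.
  have bk : (0 < b0 + k)%N by rewrite addn_gt0 b0_gt0.
  have := h bk (hb0 _ (leq_addr _ _)); congr bit_coloring.
  have : ((b0 + k)%:R : R) != 0 by rewrite pnatr_eq0 -lt0n.
  have : ((b0 + k)%:R : R) >= 0 by [].
  rewrite natrM -!natr1; move: ((b0 + k)%:R) => y y0 yn0; field.
  have y1 : 0 < y + 1 by lra.
  have y2 : 0 < y + 1 + 1 by lra.
  by rewrite yn0 !gt_eqF.
(* Starting from [d / 2] leaves room for the total loss factor [(b0 + 1) / b0 <= 2]. *)
have [n [u [c [uc ud]]]] :=
   initial_fuzzy_coloring X_compact X_hausdorff act_homeo act_FCSB E (divr_gt0 d0 (ltr0n R 2)).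
have small y : (0 < y)%N -> y.+1%:R / y%:R <= 2 :> R.
  move=> y0; rewrite ler_pdivrMr ?ltr0n// -natr1.
  have h1 : (1 : R) <= y%:R by rewrite ler1n.
  lra.
have : bit_coloring E b0 (d / 2 * (b0.+1%:R / b0%:R)).
  apply: (iter n.+1); apply: (bit_coloring_of _ uc).
    rewrite card_option card_ord; apply: leq_trans (ltnW (ltn_expl n.+1 (ltnSn 1))) _.
    by rewrite leq_exp2l// leq_addl.
  move=> m hm; apply: le_trans (ud m hm) _; rewrite ler_pMr ?divr_gt0//.
  by rewrite ler_pdivlMr ?mul1r ?ler_nat// ltr0n addn_gt0 b0_gt0.
move=> [u' [c' [uc' ud']]]; exists u', c'; split=> // m hm.
apply: le_trans (ud' m hm) _; have := small b0 b0_gt0.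
by move: (_ / b0%:R) => y hy; nra.
Qed.

End BoundedColoring.

(** * Quasitilings *)

Section BoundaryCalculus.
Context (R : realType) (G : groupType) (X : topologicalType).
Variable act : G -> X -> X.
Hypothesis act_homeo : action_by_homeo act.

Lemma boundaryPn (A : set X) x : ~ boundary A x <-> nbhs x A \/ nbhs x (~` A).
Proof.
split; first exact: notin_boundary.
move=> [hA [_ /(_ hA)//]|hA [cA _]].
by have [y [Ay /(_ Ay)]] := cA _ hA.
Qed.

Lemma boundary_preimage g (A : set X) :
  boundary (act g @^-1` A) `<=` act g @^-1` boundary A.
Proof.
move=> x; apply: contraPP => /= /boundaryPn h; apply/boundaryPn.
have ca : {for x, continuous (act g)} by have [_ c] := act_homeo; apply: c.
by case: h => h; [left|right]; exact: ca h.
Qed.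

Lemma boundary_bigcup (J : finType) (B : J -> set X) :
  boundary (\bigcup_j B j) `<=` \bigcup_j boundary (B j).
Proof.
move=> x; apply: contraPP => h; apply/boundaryPn.
have nb j : nbhs x (B j) \/ nbhs x (~` B j).
  by apply/boundaryPn => bj; apply: h; exists j.
have [[j hj]|hN] := pselect (exists j, nbhs x (B j)).
  by left; apply: filterS hj => y Bjy; exists j.
right; have : \forall y \near x, forall j, ~ B j y.
  by apply: filter_forall => j; have [hj|//] := nb j; case: hN; exists j.
by apply: filterS => y hy [j _ /hy].
Qed.

Lemma boundary_pattern (J : finType) (B : J -> set X) (W : set X) (T : {set J}) :
  boundary [set x | W x /\ [set j | `[< B j x >]]%SET = T] `<=`
  boundary W `|` \bigcup_j boundary (B j).
Proof.
move=> x; apply: contraPP => h; apply/boundaryPn.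
have loc (A : set X) : ~ boundary A x -> \forall y \near x, `[< A y >] = `[< A x >].
  move=> /boundaryPn [hA|hA]; have Ax := nbhs_singleton hA.
    by apply: filterS hA => y Ay; rewrite !asboolT.
  by apply: filterS hA => y Ay; rewrite !asboolF.
have hW := loc W (fun hw => h (or_introl hw)).
have hB : \forall y \near x, forall j, `[< B j y >] = `[< B j x >].
  by apply: filter_forall => j; apply: loc => bj; apply: h; right; exists j.
have [[Wx xT]|nx] := pselect (W x /\ [set j | `[< B j x >]]%SET = T); [left|right].
  apply: filterS2 hW hB => y Wy By; split; first by apply/asboolP; rewrite Wy asboolT.
  by rewrite -xT; apply/setP => j; rewrite !inE By.
apply: filterS2 hW hB => y Wy By [Wy' yT]; apply: nx; split.
  by apply/asboolP; rewrite -Wy asboolT.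
by rewrite -yT; apply/setP => j; rewrite !inE By.
Qed.

End BoundaryCalculus.

(** * Placing the tiles of one colour *)

Section Tiling.
Context (R : realType) (G : groupType) (X : topologicalType).
Variable act : G -> X -> X.
Hypothesis act_homeo : action_by_homeo act.
Variables (K : {fset G}) (eps : R).

Let act1 x : act 1%g x = x. Proof. by have [[h _] _] := act_homeo. Qed.
Let actM g h x : act (g * h)%g x = act g (act h x).
Proof. by have [[_ e] _] := act_homeo. Qed.
Let actK g x : act g^-1%g (act g x) = x.
Proof. by rewrite -actM mulVg act1. Qed.
Let actKV g x : act g (act g^-1%g x) = x.
Proof. by rewrite -actM mulgV act1. Qed.

Definition exit_set (A : set X) g : set X := [set z | A z /\ ~ A (act g z)].

Definition castle_support (I : finType) (S : I -> {fset G}) (V : I -> set X) :=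
  \bigcup_i tower_support act (S i) (V i).

(* A is the union of the whole tiles placed so far. The castle consists of
   disjoint open pieces of them; a bounds both the part of A that is lost and
   the boundary of A. *)
Record castle_in (A : set X) (a : R) (I : finType) (S : I -> {fset G})
    (V : I -> set X) : Prop := CastleIn {
  castle_open : forall i, open (V i);
  castle_shape : forall i, KE_invariant K eps (S i);
  castle_disjoint : forall i i' g g' x x', g \in S i -> g' \in S i' ->
    V i x -> V i' x' -> act g x = act g' x' -> i = i' /\ g = g';
  castle_sub : castle_support S V `<=` A;
  castle_loss : forall m : set X -> R, invariant_mean act m ->
    m (A `\` castle_support S V) <= a;
  castle_blur : forall m : set X -> R, invariant_mean act m ->
    m (boundary A) <= a }.

Section OneColor.
Variables (F : {fset G}) (k : nat) (b : R).
Hypothesis k_le : (k <= #|{: F}|)%N.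
Hypothesis k_half : (#|{: F}| <= 2 * (#|{: F}|.+1 - k))%N.
Hypothesis F_shape : forall T : {set F}, (#|{: F}| < #|T| + k)%N ->
  KE_invariant K eps [fset val f | f in T].

Variables (A : set X) (a : R) (I : finType) (S : I -> {fset G}) (V : I -> set X).
Hypothesis cA : castle_in A a S V.
Variable W : set X.
Hypothesis W_blur : forall m : set X -> R, invariant_mean act m -> m (boundary W) <= b.
Hypothesis W_free : forall (f f' : F) x x', W x -> W x' ->
  act (val f) x = act (val f') x' -> f = f'.

(* The tile F x of a centre x : W is kept if it has fewer than k points in A;
   its shape in the castle is then F x minus A. *)
Let hit (f : F) : set X := [set x | ~ A (act (val f) x)].
Let pattern x := [set f | `[< hit f x >]]%SET.
Let good (T : {set F}) := (#|{: F}| < #|T| + k)%N.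
Let base (T : {set F}) : set X := [set x | W x /\ pattern x = T].
Let centers : set X := [set x | W x /\ good (pattern x)].
Let copy (p : F * {T : {set F} | good T}) : set X :=
  act (val p.1)^-1%g @^-1` base (val p.2).
Let A' : set X := A `|` \bigcup_p copy p.

Let copyP z : (\bigcup_p copy p) z <-> exists f : F, centers (act (val f)^-1%g z).
Proof.
split=> [[[f [T gT]] _ [/= Wz zT]]|[f [Wz gz]]].
  by exists f; split; rewrite ?zT.
by exists (f, exist (fun T => is_true (good T)) _ gz).
Qed.

Let S' (i : I + {T : {set F} | good T}) : {fset G} :=
  match i with inl i => S i | inr T => [fset val f | f in val T] end.
Let V' (i : I + {T : {set F} | good T}) : set X :=
  match i with inl i => V i | inr T => interior (base (val T)) end.

(** There are at most [#|F| * 2 ^ #|F|] copies. Each is a translate of a base, whose boundary is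
    controlled by that of [W] and by [#|F|] translates of that of [A]. *)
Let step_const : R := (#|{: F}| * 2 ^ #|{: F}|)%:R * (b + #|{: F}|%:R * a).

Section Mean.
Variable m : set X -> R.
Hypothesis hm : invariant_mean act m.

Let base_blur T : m (boundary (base T)) <= b + #|{: F}|%:R * a.
Proof.
apply: le_trans (le_mean hm (@boundary_pattern _ _ hit W T)) _.
apply: le_trans (le_meanU hm _ _) _; rewrite lerD ?W_blur//.
apply: le_trans (le_mean_bigcup hm (@subset_refl _ _)) _.
rewrite mulr_natl -sumr_const; apply: ler_sum => f _.
have -> : hit f = act (val f) @^-1` (~` A) by [].
apply: le_trans (le_mean hm (@boundary_preimage _ _ _ act_homeo (val f) (~` A))) _.
rewrite (mean_translate hm).
apply: le_trans _ (castle_blur cA hm); apply: (le_mean hm) => x.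
by apply: contraPP => /boundaryPn h; apply/boundaryPn; rewrite setCK; tauto.
Qed.

Let sum_base (Q : {set F} -> set X) : (forall T, m (Q T) <= b + #|{: F}|%:R * a) ->
  \sum_(p : F * {T : {set F} | good T}) m (act (val p.1)^-1%g @^-1` Q (val p.2))
    <= step_const.
Proof.
move=> hQ; under eq_bigr do rewrite (mean_translate hm).
apply: (@le_trans _ _ (\sum_(p : F * {T : {set F} | good T}) (b + #|{: F}|%:R * a))).
  by apply: ler_sum => p _.
rewrite sumr_const -[leLHS]mulr_natl /step_const ler_wpM2r//.
  exact: le_trans (mean_ge0 hm _) (base_blur finset.set0).
rewrite ler_nat card_prod leq_mul// card_sig; apply: leq_trans (max_card _) _.
by rewrite -cardsT -powersetT card_powerset cardsT.
Qed.

Lemma tile_blur : m (boundary A') <= a + step_const.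
Proof.
apply: (@le_trans _ _ (m (boundary A `|` \bigcup_p boundary (copy p)))).
  apply: (le_mean hm) => x; apply: contraPP => h; apply/boundaryPn.
  have /boundaryPn[hA|hA] : ~ boundary A x by move=> ?; apply: h; left.
    by left; apply: filterS hA => y; left.
  have /boundaryPn[hB|hB] : ~ boundary (\bigcup_p copy p) x.
    by move=> /boundary_bigcup ?; apply: h; right.
    by left; apply: filterS hB => y; right.
  by right; apply: filterS2 hA hB => y ? ? [].
apply: le_trans (le_meanU hm _ _) _; rewrite lerD ?(castle_blur cA hm)//.
apply: le_trans (le_mean_bigcup hm (@subset_refl _ _)) _.
apply: le_trans (sum_base base_blur); apply: ler_sum => p _.
exact: (le_mean hm (@boundary_preimage _ _ _ act_homeo (val p.1)^-1%g (base (val p.2)))).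
Qed.

(** A new point is lost only if its centre lies in a base but not in the interior of that base. *)
Lemma tile_loss : m (A' `\` castle_support S' V') <= a + step_const.
Proof.
apply: (@le_trans _ _ (m ((A `\` castle_support S V) `|`
    \bigcup_(p : F * {T : {set F} | good T})
       act (val p.1)^-1%g @^-1` (boundary (base (val p.2)))))).
  apply: (le_mean hm) => z [A'z nz].
  have [Az|nAz] := pselect (A z).
    left; split=> // -[i _ [g gS gV]]; apply: nz.
    by exists (inl i) => //; exists g.
  case: A'z => // -[[f T] _ /= fz]; right; exists (f, T) => //=.
  split; first exact: subset_closure.
  move=> iz; apply: nz; exists (inr T) => //; exists (val f) => /=.
    apply/imfsetP; exists f => //=; case: fz => _ <-.
    by rewrite inE; apply/asboolP; rewrite /hit /= actKV.
  by exists (act (val f)^-1%g z); rewrite ?actKV.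
apply: le_trans (le_meanU hm _ _) _; rewrite lerD ?(castle_loss cA hm)//.
apply: le_trans (le_mean_bigcup hm (@subset_refl _ _)) _.
exact: sum_base base_blur.
Qed.

(** A kept tile adds at least [#|F| + 1 - k] points, which is half of it by [k_half], and tiles with
    centres in [W] are disjoint. *)
Let centers_bound : #|{: F}|%:R * m centers <= 2 * (m A' - m A).
Proof.
pose B (f : F) := centers `&` hit f.
have cnt : (#|{: F}|.+1 - k)%:R * m centers <= \sum_f m (B f).
  apply: (mean_count hm) => x [Wx gx]; rewrite leq_subLR addnC.
  apply: (leq_trans gx); rewrite leq_add2r; apply: subset_leq_card.
  apply/fintype.subsetP => f; rewrite inE => fx; rewrite inE; apply: asboolT.
  by split; [split|exact: asboolW fx].
have sumB : \sum_f m (B f) <= m (A' `\` A).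
  under eq_bigr => f _ do rewrite -(mean_translate hm (val f)^-1%g).
  apply: (sum_mean_le hm) => [f z [/= cz hz]|f f' z [[W1 _] _] [[W2 _] _]].
    split; last by move: hz; rewrite /hit /= actKV.
    by right; apply/copyP; exists f.
  by apply: (W_free W1 W2); rewrite !actKV.
rewrite (meanD hm) in sumB.
rewrite (_ : A' `&` A = A) in sumB; last first.
  by apply/seteqP; split=> x => [[]//|Ax]; split=> //; left.
apply: (@le_trans _ _ (2 * ((#|{: F}|.+1 - k)%:R * m centers))); last first.
  by rewrite ler_wpM2l//; apply: le_trans cnt sumB.
by rewrite mulrA -natrM ler_wpM2r ?(mean_ge0 hm)// ler_nat.
Qed.

(** A new point that leaves [A'] under [g] sits in a tile at one of the at most [h * #|F|] elements
    [f] with [g * f] outside [F]. Expressing the bound by the gain [m A' - m A] lets it telescope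
    over colours. *)
Lemma tile_exit g (h : R) : #|[set f : F | (g * val f)%g \notin F]%SET|%:R <= h * #|{: F}|%:R ->
  0 <= h -> m (exit_set A' g) <= m (exit_set A g) + 2 * h * (m A' - m A).
Proof.
move=> hg h0.
pose B (f : F) : set X := if (g * val f)%g \in F then set0 else act (val f)^-1%g @^-1` centers.
apply: (@le_trans _ _ (m (exit_set A g `|` \bigcup_f B f))).
  apply: (le_mean hm) => z [A'z nA'gz].
  have [Az|nAz] := pselect (A z); first by left; split=> // Agz; apply: nA'gz; left.
  case: A'z => // /copyP[f cf]; right; exists f => //; rewrite /B.
  case: ifPn => // gf; apply: nA'gz; right; apply/copyP.
  by exists [` gf]%fset; rewrite /= -actM invgM -mulgA mulVg mulg1.
apply: le_trans (le_meanU hm _ _) _; rewrite lerD2l.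
apply: le_trans (le_mean_bigcup hm (@subset_refl _ _)) _.
apply: (@le_trans _ _ (\sum_(f in [set f : F | (g * val f)%g \notin F]%SET) m centers)).
  rewrite [leRHS]big_mkcond; apply: ler_sum => f _; rewrite inE /B.
  by case: ifPn => _ /=; rewrite ?(mean_set0 hm) ?(mean_translate hm).
rewrite sumr_const -[leLHS]mulr_natl.
apply: (@le_trans _ _ (h * #|{: F}|%:R * m centers)).
  by rewrite ler_wpM2r ?(mean_ge0 hm).
by rewrite -mulrA -[2 * h]mulrC -mulrA ler_wpM2l// centers_bound.
Qed.

End Mean.

Lemma tile_one_color : exists A1 : set X,
  [/\ A `<=` A1,
      exists (I1 : finType) (S1 : I1 -> {fset G}) (V1 : I1 -> set X),
        castle_in A1 (a + step_const) S1 V1,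
      forall x, W x -> (k <= #|[set f : F | `[< A1 (act (val f) x) >]]%SET|)%N
    & forall (m : set X -> R) g (h : R), invariant_mean act m ->
        #|[set f : F | (g * val f)%g \notin F]%SET|%:R <= h * #|{: F}|%:R ->
        0 <= h -> m (exit_set A1 g) <= m (exit_set A g) + 2 * h * (m A1 - m A)].
Proof.
exists A'; split; [by left| |move=> x Wx|by move=> *; apply: tile_exit].
- exists (I + {T : {set F} | good T})%type, S', V'; split.
  + by move=> [i|T]; [exact: castle_open cA i|exact: open_interior].
  + by move=> [i|[T gT]]; [exact: castle_shape cA i|exact: F_shape].
  + have hitA (f : G) (T : {T : {set F} | good T}) x :
         f \in [fset val f | f in val T]%fset -> base (val T) x ->
        ~ A (act f x).
      by move=> /imfsetP[f' /= f'T ->] [_ xT]; move: f'T; rewrite -xT inE => /asboolP.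
    have oldA i g x : g \in S i -> V i x -> A (act g x).
      by move=> gS Vx; apply: (castle_sub cA); exists i => //; exists g => //; exists x.
    move=> [i|T] [i'|T'] g g' x x' /= gS gS' Vx Vx' e.
    * by have [-> ->] := castle_disjoint cA gS gS' Vx Vx' e.
    * by case: (hitA _ _ _ gS' (interior_subset Vx')); rewrite -e; apply: oldA gS Vx.
    * by case: (hitA _ _ _ gS (interior_subset Vx)); rewrite e; apply: oldA gS' Vx'.
    * have {}Vx := interior_subset Vx; have {}Vx' := interior_subset Vx'.
      move: gS gS' => /imfsetP[f /= fT fE] /imfsetP[f' /= fT' fE'].
      have ff' : f = f' by apply: (W_free Vx.1 Vx'.1); move: e; rewrite fE fE'.
      have gg : g = g' by rewrite fE fE' ff'.
      have xx : x = x' by rewrite -(actK g x) e gg actK.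
      split=> //; congr inr; apply: val_inj.
      by apply: etrans (esym Vx.2) (etrans _ Vx'.2); rewrite xx.
  + move=> z [[i|T] _ [g gS [x Vx <-]]]; first by left;
       apply: (castle_sub cA); exists i => //; exists g => //; exists x.
    right; have /imfsetP[f /= fT ->] := gS; exists (f, T) => //.
    by rewrite /copy /= actK; exact: interior_subset Vx.
  + exact: tile_loss.
  + exact: tile_blur.
(* A kept tile is covered entirely; a rejected one already had [k] points in [A]. *)
- have [gx|gx] := boolP (good (pattern x)).
    apply: leq_trans k_le _; rewrite -cardsT; apply: subset_leq_card.
    apply/fintype.subsetP => f _; rewrite inE; apply/asboolP; right; apply/copyP.
    by exists f; rewrite actK.
  move: gx; rewrite /good -leqNgt => gx.
  rewrite -(leq_add2l #|pattern x|); apply: leq_trans gx _.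
  rewrite -cardsT -cardsUI; apply: leq_trans (leq_addr _ _).
  apply: subset_leq_card; apply/fintype.subsetP => f _; rewrite !inE.
  have [h|/contrapT h] := pselect (~ A (act (val f) x)); apply/orP; [left|right]; apply/asboolP => //.
  by left.
Qed.

End OneColor.
End Tiling.

(** * Iteration over colours and shapes *)

Lemma card_fset_pred (T : choiceType) (F : {fset T}) (P : pred T) :
  #|[set f : F | P (val f)]%SET| = #|` [fset s in F | P s]|.
Proof.
have -> : [fset s in F | P s]%fset = [fset val f | f in [set f : F | P (val f)]%SET]%fset.
  apply/fsetP => s; rewrite !inE /=; apply/andP/imfsetP => [[sF Ps]|[f /= Pf ->]].
    by exists [` sF]%fset => //=; rewrite inE.
  by move: Pf; rewrite inE => ->; rewrite (valP f).
by rewrite card_imfset ?cardE//; exact: val_inj.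
Qed.

(** If [s] is in [T] but [g^-1 * s] is not, then [g^-1 * s] is outside [F] or in [F] minus [T], each
    for at most [d * #|F|] values of [s]. Summing over [K] leaves the set [stay], contained in every
    translate [g T]. *)
Lemma Folner_subset_shape (R : realType) (G : groupType) (K F T : {fset G})
    (eps d : R) : F != fset0 -> 0 <= d ->
  (1 + 2 * #|` K|%:R) * d < eps -> (1 + 2 * #|` K|%:R) * d < 1 ->
  (forall g, g \in K -> #|` [fset s in F | (g^-1 * s)%g \notin F]|%:R <= d * #|` F|%:R) ->
  (T `<=` F)%fset -> (1 - d) * #|` F|%:R <= #|` T|%:R ->
  KE_invariant K eps T.
Proof.
move=> F0 d0 deps d1 KF TF Tbig.
have cF : (0 : R) < #|` F|%:R by rewrite ltr0n cardfs_gt0.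
pose bad g := [fset s in T | (g^-1 * s)%g \notin T]%fset.
have badK g : g \in K -> #|` bad g|%:R <= 2 * d * #|` F|%:R.
  move=> gK; have /fsubset_leq_card : (bad g `<=` [fset s in F | (g^-1 * s)%g \notin F]
      `|` [fset (g * s)%g | s in F `\` T])%fset.
    apply/fsubsetP => s; rewrite !inE /= => /andP[sT gsT].
    rewrite (fsubsetP TF _ sT) /=.
    have [gsF|//] := boolP ((g^-1 * s)%g \in F); apply/imfsetP.
    by exists (g^-1 * s)%g; rewrite ?mulVKg// !inE gsT gsF.
  rewrite cardfsU => /leq_trans /(_ (leq_subr _ _)).
  have im : (#|` [fset (g * s)%g | s in F `\` T]%fset| <= #|` (F `\` T)%fset|)%N.
    exact: leq_imfset_card.
  move=> /leq_trans /(_ (leq_add (leqnn _) im)).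
  rewrite -(ler_nat R) natrD => /le_trans; apply.
  have -> : 2 * d * #|` F|%:R = d * #|` F|%:R + d * #|` F|%:R by ring.
  apply: lerD (KF g gK) _.
  rewrite cardfsDS// natrB ?fsubset_leq_card//; lra.
pose stay := [fset s in T | all (fun g => (g^-1 * s)%g \in T) (enum_fset K)]%fset.
have stay_bound : (1 - (1 + 2 * #|` K|%:R) * d) * #|` F|%:R <= #|` stay|%:R.
  have : #|` T|%:R <= #|` stay|%:R + \sum_(g <- enum_fset K) #|` bad g|%:R :> R.
    rewrite -natr_sum -natrD ler_nat /stay; elim: (enum_fset K) => [|g s IH].
      rewrite big_nil addn0; apply: fsubset_leq_card; apply/fsubsetP => z zT.
      by rewrite !inE /= zT.
    rewrite big_cons; apply: (leq_trans IH); rewrite addnA leq_add2r.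
    rewrite -cardfsUI; apply: leq_trans (leq_addr _ _); apply: fsubset_leq_card.
    apply/fsubsetP => z; rewrite !inE /= => /andP[-> ->] /=; rewrite andbT.
    by case: ((_ \in T)).
  have : \sum_(g <- enum_fset K) #|` bad g|%:R <= #|` K|%:R * (2 * d * #|` F|%:R) :> R.
    rewrite big_seq.
    apply: (@le_trans _ _ (\sum_(g <- enum_fset K | g \in enum_fset K) (2 * d * #|` F|%:R))).
      by apply: ler_sum => g; exact: badK.
    by rewrite -big_seq big_const_seq count_predT iter_addr_0 [leRHS]mulr_natl.
  move=> h1 h2; lra.
rewrite /KE_invariant; apply: (@lt_le_trans _ _ (#|` stay|%:R)%:E); last first.
  apply: counting_ge => z /=; rewrite !inE /= => /andP[zT /allP zs] g gK.
  by exists (g^-1 * z)%g; rewrite ?mulVKg//=; apply: zs.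
rewrite lte_fin; apply: lt_le_trans stay_bound.
have TleF : #|` T|%:R <= #|` F|%:R :> R by rewrite ler_nat fsubset_leq_card.
have dK : d <= (1 + 2 * #|` K|%:R) * d.
  by rewrite ler_peMl// lerDl mulr_ge0.
have T0 : (0 : R) < #|` T|%:R.
  by apply: lt_le_trans Tbig; rewrite mulr_gt0// subr_gt0; apply: le_lt_trans d1.
apply: (@lt_le_trans _ _ ((1 - (1 + 2 * #|` K|%:R) * d) * #|` T|%:R)).
  by rewrite ltr_pM2r// ltrD2l ltrN2.
by rewrite ler_wpM2l// subr_ge0 ltW.
Qed.

(** Arithmetic of one shape: [na] and [na1] are the uncovered means before and after, [z] that of
    the coloured points whose whole tile is uncovered, [q] a power of [1 - d], [c] the size of the
    shape, [r] the previous error. The value of [rho] absorbs [(c + 1) r]. *)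
Lemma uncovered_step (R : realType) (d q r b n c z na na1 rho : R) :
  0 <= d -> d <= 1 -> 0 <= r -> 0 <= b -> 0 <= n -> 0 <= c ->
  rho = 2 * (c + 1) * r -> na1 <= na - d * z -> na <= z + c * r + b ->
  na <= q + r + n * b -> na1 <= (1 - d) * q + rho + (n + 1) * b.
Proof.
move=> d0 d1 r0 b0 n0 c0 -> h1 h2 h3.
have e1 : d * na <= d * (z + c * r + b) by rewrite ler_wpM2l.
have e2 : (1 - d) * na <= (1 - d) * (q + r + n * b) by rewrite ler_wpM2l// subr_ge0.
have e3 : 0 <= d * r by rewrite mulr_ge0.
have e4 : 0 <= d * (n * b) by rewrite !mulr_ge0.
have e5 : 0 <= c * r by rewrite mulr_ge0.
have e6 : d * (c * r) <= c * r by rewrite ler_piMl.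
have e7 : d * b <= b by rewrite ler_piMl.
lra.
Qed.

Section Quasitiling.
Context (R : realType) (G : groupType) (X : topologicalType).
Variable act : G -> X -> X.
Hypothesis act_homeo : action_by_homeo act.
Variables (K : {fset G}) (eps : R).

Let act1 x : act 1%g x = x. Proof. by have [[h _] _] := act_homeo. Qed.
Let actM g h x : act (g * h)%g x = act g (act h x).
Proof. by have [[_ e] _] := act_homeo. Qed.

Definition castled (A : set X) (a : R) :=
  exists (I : finType) (S : I -> {fset G}) (V : I -> set X),
    castle_in act K eps A a S V.

Section Stage.
Variables (F : {fset G}) (k : nat) (b : R) (J : finType) (U : J -> set X).
Hypothesis k_le : (k <= #|{: F}|)%N.
Hypothesis k_half : (#|{: F}| <= 2 * (#|{: F}|.+1 - k))%N.
Hypothesis F_shape : forall T : {set F}, (#|{: F}| < #|T| + k)%N ->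
  KE_invariant K eps [fset val f | f in T].
Hypothesis U_blur : forall j (m : set X -> R), invariant_mean act m ->
  m (boundary (U j)) <= b.
Hypothesis U_free : forall j (f f' : F) x x', U j x -> U j x' ->
  act (val f) x = act (val f') x' -> f = f'.

(** This is [a + step_const] for [a = C * b], with the factor [b] taken out. *)
Definition stage_const (C : R) : R :=
  C + (#|{: F}| * 2 ^ #|{: F}|)%:R * (1 + #|{: F}|%:R * C).

(** Later colours only enlarge the covered set, so the count obtained for an earlier colour
    persists, and the gains telescope. *)
Lemma tile_stage (s : seq J) (C : R) A : castled A (C * b) ->
  exists A1 : set X,
  [/\ A `<=` A1, castled A1 (iter (size s) stage_const C * b),
      forall j x, j \in s -> U j x ->
        (k <= #|[set f : F | `[< A1 (act (val f) x) >]]%SET|)%N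
    & forall (m : set X -> R) (g : G) (h : R), invariant_mean act m ->
        #|[set f : F | (g * val f)%g \notin F]%SET|%:R <= h * #|{: F}|%:R ->
        0 <= h ->
        m (exit_set act A1 g) <= m (exit_set act A g) + 2 * h * (m A1 - m A)].
Proof.
elim: s => [|j s IH] cA.
  exists A; split=> // m g h hm _ _.
  by rewrite subrr mulr0 addr0.
have [A1 [AA1 [I [S [V cA1]]] hU1 ex1]] := IH cA.
have [A2 [A12 [I2 [S2 [V2 cA2]]] hU2 ex2]] :=
  tile_one_color act_homeo k_le k_half F_shape cA1 (U_blur j) (@U_free j).
exists A2; split.
- by apply: subset_trans A12.
- exists I2, S2, V2.
  have -> : iter (size (j :: s)) stage_const C * b = iter (size s) stage_const C * b +
      (#|{: F}| * 2 ^ #|{: F}|)%:R * (b + #|{: F}|%:R * (iter (size s) stage_const C * b)).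
    by rewrite /= /stage_const; ring.
  exact: cA2.
- move=> i x; rewrite inE => /orP[/eqP ->|i_s] Ux; first exact: hU2.
  apply: leq_trans (hU1 i x i_s Ux) _; apply: subset_leq_card.
  apply/fintype.subsetP => f; rewrite inE => fx; rewrite inE; apply: asboolT.
  exact: A12 (asboolW fx).
- move=> m g h hm hg h0; apply: le_trans (ex2 m g h hm hg h0) _.
  by have := ex1 m g h hm hg h0; lra.
Qed.

End Stage.

Variable d : R.
Hypothesis d_gt0 : 0 < d.
Hypothesis d_half : d <= 1/2.
Hypothesis d_eps : (1 + 2 * #|` K|%:R) * d < eps.
Hypothesis d_1 : (1 + 2 * #|` K|%:R) * d < 1.
Hypothesis G_amenable : amenable R G.

Let d_lt1 : d < 1.
Proof. move: d_half; lra. Qed.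

(* The shape used last is chosen first, so that the larger shapes used before it
   are almost invariant under it (last clause): hence most of what they leave
   uncovered is far from A, and a proportion d of it is then covered. *)
Lemma quasitiling n (H : {fset G}) (rho : R) : 0 < rho ->
  exists E : {fset G}, forall J : finType, exists2 C : R, 0 <= C &
  forall (b : R) (U : J -> set X), 0 <= b ->
    (forall j, open (U j)) ->
    (forall j g x, g \in E -> U j x -> U j (act g x) -> g = 1%g) ->
    (forall i j x, U i x -> U j x -> i = j) ->
    (forall m : set X -> R, invariant_mean act m -> m (~` \bigcup_j U j) <= b) ->
  exists A : set X,
  [/\ castled A (C * b),
      forall m : set X -> R, invariant_mean act m ->
        m (~` A) <= (1 - d) ^+ n + rho + n%:R * b
    & forall (m : set X -> R) g, invariant_mean act m -> g \in H ->
        m (exit_set act A g) <= rho].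
Proof.
elim: n H rho => [|n IH] H rho rho0.
  exists fset0 => J; exists 0 => // b U b0 _ _ _ _; exists set0; split.
  - have no (P : void -> Prop) i : P i by case: i.
    exists void, (fun i : void => match i with end), (fun i : void => match i with end).
    split=> //; try by move=> [].
    + by move=> x [[]].
    + by move=> m hm; rewrite set0D (mean_set0 hm) mul0r.
    + move=> m hm; rewrite mul0r (_ : boundary set0 = set0) ?(mean_set0 hm)//.
      by rewrite /boundary closure0 set0D.
  - by move=> m hm; rewrite expr0 mul0r addr0 (le_trans (mean_le1 hm _))// lerDl ltW.
  - move=> m g hm _; rewrite (_ : exit_set _ _ _ = set0) ?(mean_set0 hm) ?ltW//.
    by apply/seteqP; split=> x // [].
(* The bound by [d] serves the invariance of the shapes under [K], the bound by [rho / 4] the exit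
   set under [H]. *)
have [eta [eta0 eta_d eta_rho]] : exists eta, [/\ 0 < eta, eta <= d & eta <= rho / 4].
  by exists (Num.min d (rho / 4)); rewrite lt_min d_gt0 divr_gt0// !ge_min !lexx orbT.
have [F F0 hF] := amenable_Folner G_amenable ([fset g^-1%g | g in K] `|` H)%fset eta0.
have [N NE] : exists N, N = #|{: F}| by exists #|{: F}|.
have NF : N = #|` F| by rewrite NE cardfE.
have N0 : (0 < N)%N by rewrite NF cardfs_gt0.
(* With [k = t + 1], a kept tile loses at most [t <= d * N] points, and a rejected one has more than
   [d * N] points covered. *)
have [t /andP[t1 t2]] : exists t : nat, t%:R <= d * N%:R < t.+1%:R.
  exists (Num.truncn (d * N%:R)); apply: truncn_itv.
  by rewrite mulr_ge0// ltW.
pose k := t.+1.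
have N0R : (0 : R) < N%:R by rewrite ltr0n.
have tN : (t < N)%N.
  by rewrite -(ltr_nat R); apply: le_lt_trans t1 _; rewrite gtr_pMl.
have t2N : (2 * t <= N)%N.
  rewrite -(ler_nat R) natrM; move: d_half N0R t1; nra.
have [rho1 rho1_gt0 rhoE] : exists2 rho1, 0 < rho1 & rho = 2 * (N%:R + 1) * rho1.
  have N1 : (0 : R) < 2 * (N%:R + 1) by rewrite mulr_gt0// addr_gt0.
  exists (rho / (2 * (N%:R + 1))); first by rewrite divr_gt0.
  by rewrite mulrC divfK// gt_eqF.
(* The earlier tiles are also made almost invariant under [F], with an error [rho1] small enough to
   be paid [N] times. *)
have [E hE] := IH (H `|` F)%fset rho1 rho1_gt0.
(* The quotients [f^-1 * f'] make the tiles around centres of one colour disjoint. *)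
exists (E `|` [fset (f^-1 * f')%g | f in F, f' in F])%fset => J.
have [C C0 hC] := hE J.
have iter_ge0 p : 0 <= iter p (stage_const F) C.
  elim: p => //= p hp; rewrite /stage_const addr_ge0// mulr_ge0// addr_ge0//.
  by rewrite mulr_ge0.
exists (iter #|J| (stage_const F) C) => // b U b0 oU freeU disjU smallU.
have freeE j g x : g \in E -> U j x -> U j (act g x) -> g = 1%g.
  by move=> gE; apply: freeU; rewrite inE gE.
have [A [cA unA exA]] := hC b U b0 oU freeE disjU smallU.
have F_shape (T : {set F}) : (#|{: F}| < #|T| + k)%N ->
    KE_invariant K eps [fset val f | f in T].
  move=> hT; apply: (@Folner_subset_shape _ _ _ F _ eps d) => //.
  - exact: ltW.
  - move=> g gK; apply: (@le_trans _ _ (eta * #|` F|%:R)).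
      by apply: hF; rewrite inE in_imfset.
    by rewrite ler_wpM2r.
  - by apply/fsubsetP => s /imfsetP[f _ ->]; exact: valP.
  - rewrite -NF card_imfset; last exact: val_inj.
    rewrite -[X in _ <= X%:R]/(size (enum T)) -cardE.
    have : (N <= #|T| + t)%N by rewrite NE -ltnS -addnS.
    by rewrite -(ler_nat R) natrD; lra.
have U_blur j (m : set X -> R) : invariant_mean act m -> m (boundary (U j)) <= b.
  (* The colour classes are open and disjoint, so the boundary of one misses all of them. *)
  move=> hm; apply: le_trans (smallU m hm); apply: (le_mean hm) => x [cU nU] [i _ Ui].
  have ni : nbhs x (U i) by apply: open_nbhs_nbhs; split.
  have [y [Ujy Uiy]] := cU _ ni; have ij := disjU _ _ _ Uiy Ujy.
  by apply: nU; rewrite ij in ni.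
have U_free j (f f' : F) x x' : U j x -> U j x' ->
    act (val f) x = act (val f') x' -> f = f'.
  move=> Ux Ux' e; pose g := ((val f)^-1 * val f')%g.
  have gx : act g x' = x by rewrite /g actM -e -actM mulVg act1.
  have g1 : g = 1%g.
    apply: (freeU j _ x'); rewrite ?gx// !inE; apply/orP; right.
    by apply/imfset2P; exists (val f); [exact: valP|exists (val f') => //; exact: valP].
  by apply: val_inj; rewrite -[LHS]mulg1 -g1 /g mulVKg.
have k_le : (k <= #|{: F}|)%N by rewrite -NE.
have k_half : (#|{: F}| <= 2 * (#|{: F}|.+1 - k))%N.
  rewrite -NE /k subSS mulnBr leq_subRL; last by rewrite leq_mul2l (ltnW tN).
  by rewrite [leqRHS]mul2n -addnn leq_add2r.
have [A1 [AA1 cA1 hitA1 exA1]] := tile_stage k_le k_half F_shape U_blur U_free (index_enum J) cA.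
exists A1; split.
- by move: cA1; rewrite -[index_enum J]enumT -cardE.
- move=> m hm.
  (* The tile of a point of [Z] starts out uncovered, so the stage adds at least [k > d * N] of its
     points. *)
  pose Z : set X := [set x | [/\ ~ A x, forall f : F, ~ A (act (val f) x) & (\bigcup_j U j) x]].
  have hZ : d * m Z <= m A1 - m A.
    rewrite -(ler_pM2l N0R) mulrCA mulrA.
    apply: (@le_trans _ _ (k%:R * m Z)).
      by rewrite ler_wpM2r ?(mean_ge0 hm)// ltW.
    pose B (f : F) : set X := act (val f) @^-1` (A1 `\` A).
    apply: (@le_trans _ _ (\sum_f m (B f))).
      apply: (mean_count hm) => x [_ nAf [j _ Ujx]].
      apply: leq_trans (hitA1 j x (mem_index_enum j) Ujx) _; apply: subset_leq_card.
      apply/fintype.subsetP => f; rewrite inE => fx; rewrite inE; apply: asboolT.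
      by split; [exact: asboolW fx|exact: nAf].
    under eq_bigr do rewrite (mean_translate hm).
    rewrite sumr_const -NE -[leLHS]mulr_natl ler_wpM2l// (meanD hm).
    rewrite (_ : A1 `&` A = A)//; apply/seteqP; split=> x; first by case.
    by move=> Ax; split=> //; apply: AA1.
  have hC' : m (~` A) <= m Z + N%:R * rho1 + b.
    (* By invariance [Q f] has the same mean as the exit set of [f], which is at most [rho1]. *)
    pose Q (f : F) : set X := act (val f) @^-1` A `\` A.
    apply: (@le_trans _ _ (m ((Z `|` \bigcup_f Q f) `|` ~` \bigcup_j U j))).
      apply: (le_mean hm) => x nAx.
      have [Ux|] := pselect ((\bigcup_j U j) x); last by right.
      left; have [h|/existsNP[f /contrapT hf]] := pselect (forall f : F, ~ A (act (val f) x)).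
        by left.
      by right; exists f.
    apply: le_trans (le_meanU hm _ _) _; rewrite lerD ?smallU//.
    apply: le_trans (le_meanU hm _ _) _; rewrite lerD2l.
    apply: le_trans (le_mean_bigcup hm (@subset_refl _ _)) _.
    rewrite NE mulr_natl -sumr_const; apply: ler_sum => f _.
    apply: (@le_trans _ _ (m (exit_set act A (val f)))); last first.
      by apply: exA => //; rewrite inE (valP f) orbT.
    have -> : exit_set act A (val f) = A `\` act (val f) @^-1` A by [].
    by rewrite /Q !(meanD hm) (mean_translate hm) setIC.
  have un := unA m hm; have := mean_setC hm A; have := mean_setC hm A1.
  rewrite exprS -natr1 => m1 m2.
  apply: (uncovered_step (d := d) (z := m Z) (c := N%:R) (r := rho1) (na := m (~` A))) => //.
  - exact: ltW.
  - exact: ltW.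
  - exact: ltW.
  - by rewrite m1 m2; move: hZ; lra.
- move=> m g hm gH.
  have hg : #|[set f : F | (g * val f)%g \notin F]%SET|%:R <= eta * #|{: F}|%:R.
    rewrite (card_fset_pred F (fun s => (g * s)%g \notin F)) -NE NF.
    by apply: hF; rewrite inE gH orbT.
  apply: le_trans (exA1 m g eta hm hg (ltW eta0)) _.
  have e1 : m (exit_set act A g) <= rho1 by apply: exA => //; rewrite inE gH.
  have e2 : rho1 <= rho / 2.
    have : 0 <= N%:R * rho1 by rewrite mulr_ge0// ltW.
    by rewrite rhoE; lra.
  have := mean_le1 hm A1; have := mean_ge0 hm A; have := le_mean hm AA1.
  move: (m (exit_set _ _ _)) (m A) (m A1) e1 => z a a1 e1 h1 h2 h3.
  have : 2 * eta * (a1 - a) <= 2 * eta * 1 by rewrite ler_wpM2l; [|rewrite mulr_ge0// ltW|lra].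
  lra.
Qed.

End Quasitiling.

(** * Choice of parameters and assembly of the castle *)

Lemma exists_exprn_lt (R : realType) (x e : R) : 0 <= x < 1 -> 0 < e -> exists n, x ^+ n < e.
Proof.
move=> /andP[x0 x1] e0; have xn : `|x| < 1 by rewrite ger0_norm.
have := cvgr_lt 0 (cvg_geometric 1 xn) e e0 => -[n _ /(_ n (leqnn n))] /=.
by rewrite mul1r; exists n.
Qed.

Theorem theorem3 (R : realType) (G : groupType) (X : topologicalType)
    (act : G -> X -> X)
    (G_countable : countable [set: G])
    (G_infinite : infinite_set [set: G])
    (G_amenable : amenable R G)
    (X_compact : compact [set: X])
    (X_metrizable : metrizable R X)
    (act_homeo : action_by_homeo act)
    (act_free : free_action act)
    (act_FCSB : FCSB_in_measure R act) :
  URP R act.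
Proof.
move=> K e e0; have X_hausdorff := metrizable_hausdorff X_metrizable.
pose c : R := 1 + 2 * #|` K|%:R.
have c1 : 1 <= c by rewrite /c lerDl mulr_ge0.
have c0 : 0 < c by apply: lt_le_trans c1.
have [d [d0 d_half d_e d_1]] : exists d, [/\ 0 < d, d <= 1/2, c * d < e & c * d < 1].
  exists (Num.min e 1 / (2 * c)); have m0 : 0 < Num.min e 1 by rewrite lt_min e0 ltr01.
  have m1 : Num.min e 1 <= 1 by rewrite ge_min lexx orbT.
  have me : Num.min e 1 <= e by rewrite ge_min lexx.
  have -> : c * (Num.min e 1 / (2 * c)) = Num.min e 1 / 2.
    by field; rewrite gt_eqF.
  split.
  - by rewrite divr_gt0// mulr_gt0.
  - rewrite ler_pdivrMr ?mulr_gt0//; apply: (le_trans m1).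
    by rewrite mul1r mulKf.
  - by apply: lt_le_trans me; rewrite ltr_pdivrMr// ltr_pMr// ltr1n.
  - by apply: lt_le_trans m1; rewrite ltr_pdivrMr// ltr_pMr// ltr1n.
have d_lt1 : d < 1 by apply: le_lt_trans d_half _; rewrite ltr_pdivrMr// mul1r ltr1n.
have e4 : 0 < e / 4 by rewrite divr_gt0.
have [n hn] : exists n, (1 - d) ^+ n < e / 4.
  by apply: exists_exprn_lt => //; rewrite subr_ge0 ltW// gtrBl.
have [E hE] := quasitiling act_homeo d0 d_half d_e d_1 G_amenable n fset0 e4.
(* The order of choices is essential: [E] comes from [n], [b] from [E], [C] from [b], and only then
   is the size [r] of the uncoloured set fixed against [n + C]. *)
have [b hb] := bounded_coloring act_homeo X_compact X_hausdorff act_FCSB E.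
have [C C0 hC] := hE {ffun 'I_b -> bool}.
have nC0 : 0 < n%:R + C + 1 by rewrite ltr_wpDl ?addr_ge0.
have [r r0 hr] : exists2 r, 0 < r & (n%:R + C + 1) * r = e / 4.
  by exists (e / 4 / (n%:R + C + 1)); [rewrite divr_gt0|rewrite mulrC divfK// gt_eqF].
have [u [col [ucol hu]]] := hb r r0.
pose U (j : {ffun 'I_b -> bool}) : set X := [set x | u x < 1 /\ col x = j].
have near_u x : u x < 1 -> \forall y \near x, u y < 1.
  by move=> ux; apply: (cvgr_lt (u x)) => //; exact: (fuzzy_continuous ucol).
have [||||A [[I [S [V cA]]] unA _]] := hC r U (ltW r0).
- move=> j; rewrite openE => x [ux cx].
  by apply: filterS2 (near_u x ux) (fuzzy_loc ucol ux) => y uy cy; split; rewrite ?cy.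
- move=> j g x gE [ux cx] [ugx cgx]; apply/eqP; apply: contrapT => /negP g1.
  by apply: (fuzzy_proper ucol gE g1 ux ugx); rewrite cx cgx.
- by move=> i j x [_ <-] [_ <-].
- move=> m hm; apply: le_trans (hu m hm); apply: (le_mean hm) => x nx /=.
  rewrite ltNge; apply/negP => ux; apply: nx; exists (col x) => //; split=> //.
  exact: le_lt_trans ux ltr01.
exists #|I|, (fun i => S (enum_val i)), (fun i => V (enum_val i)); split.
- split=> [i|].
    split; first exact: castle_open cA _.
    move=> g g' gS gS' [_ [[x Vx <-] [x' Vx' e']]].
    by have [_ ->] := castle_disjoint cA gS gS' Vx Vx' (esym e').
  move=> i i' _ _ [z [[g gS [x Vx xz]] [g' gS' [x' Vx' xz']]]].
  have [e1 _] := castle_disjoint cA gS gS' Vx Vx' (etrans xz (esym xz')).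
  exact: enum_val_inj.
- by move=> i; exact: castle_shape cA _.
apply: upper_banach_density_lt => //; first by have [] := act_homeo.
move=> m hm.
have -> : \bigcup_(i in [set: 'I_#|I|]) tower_support act (S (enum_val i)) (V (enum_val i)) =
    castle_support act S V.
  apply/seteqP; split=> z [i _ hi]; first by exists (enum_val i).
  by exists (enum_rank i) => //; rewrite enum_rankK.
apply: (@le_lt_trans _ _ (m (~` A) + m (A `\` castle_support act S V))).
  apply: le_trans (le_meanU hm _ _); apply: (le_mean hm) => z nz.
  by have [Az|] := pselect (A z); [right|left].
(* The power, the error [e / 4] and the sum [n * r + C * r] are each at most [e / 4]. *)
apply: (@le_lt_trans _ _ (((1 - d) ^+ n + e / 4 + n%:R * r) + C * r)).
  by apply: lerD; [exact: unA|exact: castle_loss cA m hm].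
have hr2 : n%:R * r + C * r + r = e / 4 by rewrite -hr; ring.
by move: (n%:R * r) (C * r) ((1 - d) ^+ n) hn r0 hr2 => x y z; lra.
Qed.
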